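(* Let $\lambda>-1/2$, $\eta\in\mathbb R$, $b=\lambda+\mathrm i\eta$, and $\nu(z)=(-z)^{-\overline b}(1-z)^{b+\overline b}$ on $\mathbb T$. Then for every $n\in\mathbb N$ the matrix function $\widetilde M_n(z)=z(1-z)M_n(z)$ is $$\widetilde M_n(z)=\begin{bmatrix}-\frac{(b+n)z+(\overline b+n)(2|\alpha_{n-1}|^2-1)}{2}&-b_n^{-1}(\overline b+n)\overline{\alpha}_{n-1}\\[4pt]-b_{n-1}(\overline b+n)\alpha_{n-1}&\frac{(b+n)z+(\overline b+n)(2|\alpha_{n-1}|^2-1)}{2}\end{bmatrix}.$$
   Context: $\mathbb N=\{1,2,\dots\}$, $\mathbb T=\{|z|=1\}$ (counterclockwise), $d\mu(z)=\frac{\nu(z)}{\mathrm i z}dz$. Powers are principal branches, so $\nu(e^{\mathrm i\theta})=e^{-\eta(\theta-\pi)}(4\sin^2(\theta/2))^{\lambda}$ for $0<\theta<2\pi$. $\Phi_n$ is the monic polynomial of degree $n$ with $\int_{\mathbb T}\Phi_n\overline{\Phi_m}\,d\mu=\kappa_n^{-2}\delta_{n,m}$, $\kappa_n>0$; $\Phi_n^*(z)=z^n\overline{\Phi_n(1/\bar z)}$; $\alpha_{n-1}=-\overline{\Phi_n(0)}$ for $n\ge1$; the subscripted quantity $b_n=2\pi\kappa_n^2$ is not to be confused with the parameter $b$. For $z\notin\mathbb T$, $$G_n(z)=\frac1{2\pi \mathrm i}\int_{\mathbb T}\frac{\Phi_n(t)}{t-z}\frac{\nu(t)}{t^n}dt,\quad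 G_{n-1}^*(z)=\frac1{2\pi \mathrm i}\int_{\mathbb T}\frac{\Phi_{n-1}^*(t)}{t-z}\frac{\nu(t)}{t^n}dt,\quad Y_n=\begin{bmatrix}\Phi_n&G_n\\-b_{n-1}\Phi_{n-1}^*&-b_{n-1}G_{n-1}^*\end{bmatrix}\quad(n\in\mathbb N).$$ $C_n(z)=\operatorname{diag}\big(z^{-n/2}\nu(z)^{1/2},\,z^{n/2}\nu(z)^{-1/2}\big)$, $Z_n=Y_nC_n$, $M_n=Z_n'Z_n^{-1}=Y_n'Y_n^{-1}+Y_nC_n'C_n^{-1}Y_n^{-1}$, where $C_n'C_n^{-1}=\big(-\frac{n+\overline b}{2z}-\frac{b+\overline b}{2(1-z)}\big)\operatorname{diag}(1,-1)$ independently of the local branches chosen in $C_n$. *)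

(* Defs.v *)
From mathcomp Require Import all_boot all_order all_algebra.
From mathcomp Require Import complex.
From mathcomp Require Import all_classical all_reals all_analysis.

Set Implicit Arguments.
Unset Strict Implicit.
Unset Printing Implicit Defensive.

Import Order.TTheory GRing.Theory Num.Theory.
Import numFieldNormedType.Exports.

Local Open Scope classical_set_scope.
Local Open Scope complex_scope.
Local Open Scope ring_scope.

(* Differentiability and derivatives over [K := R[i]] are complex ones.  They
   are stated for an arbitrary [K] so that lemmas about them can be proved
   generically: unification inside the topological structures of the concrete
   type [R[i]] is very slow. *)
Definition holomorphic_near (K : numFieldType) (f : K -> K) (z : K) : Prop :=
  \forall w \near z, derivable f w 1.

Definition eq_near (K : numFieldType) (T : Type) (f g : K -> T) (z : K) : Prop :=
  \forall w \near z, f w = g w.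

Definition cderive (K : numFieldType) (f : K -> K) (z : K) : K := derive1 f z.

Definition mx_cderive (K : numFieldType) (m n : nat) (F : K -> 'M[K]_(m, n))
    (z : K) : 'M[K]_(m, n) :=
  \matrix_(i, j) cderive (fun w => F w i j) z.

Definition mx2 (K : Type) (a b c d : K) : 'M[K]_2 :=
  \matrix_(i, j) if i == 0 then (if j == 0 then a else b)
                 else (if j == 0 then c else d).

Definition cexp (R : realType) (z : R[i]) : R[i] :=
  (expR (complex.Re z))%:C * (cos (complex.Im z) +i* sin (complex.Im z)).

(* The modulus as an element of [R]; the library's norm on [R[i]] takes its
   values in [R[i]]. *)
Definition cmod (R : realType) (z : R[i]) : R := complex.Re `|z|.

(* Principal argument, in ]-pi, pi] for z <> 0. *)
Definition carg (R : realType) (z : R[i]) : R :=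
  let a := acos (complex.Re z / cmod z) in
  if 0 <= complex.Im z then a else - a.

(* Principal logarithm and principal powers; the values at z = 0 are
   meaningless. *)
Definition cln (R : realType) (z : R[i]) : R[i] := ln (cmod z) +i* carg z.

Definition cpow (R : realType) (z s : R[i]) : R[i] := cexp (s * cln z).

(* [nu b] is used on the unit circle only, and its value at z = 1 is irrelevant
   since {1} is negligible. *)
Definition nu (R : realType) (b z : R[i]) : R[i] :=
  cpow (- z) (- b^*) * cpow (1 - z) (b + b^*).

Definition cintegral (R : realType) (D : set R) (f : R -> R[i]) : R[i] :=
  (\int[lebesgue_measure]_(x in D) complex.Re (f x)) +i*
  (\int[lebesgue_measure]_(x in D) complex.Im (f x)).

(* The contour integral of [f z dz] over the counterclockwise unit circle. *)
Definition circle_integral (R : realType) (f : R[i] -> R[i]) : R[i] :=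
  cintegral `]0, 2 * pi[
    (fun theta => let t := cexp (0 +i* theta) in f t * ('i%C * t)).

(* Integration against d mu(z) = nu(z) / (i z) dz. *)
Definition mu_integral (R : realType) (b : R[i]) (f : R[i] -> R[i]) : R[i] :=
  circle_integral (fun t => f t * (nu b t / ('i%C * t))).

Definition is_monic_OPUC (R : realType) (b : R[i])
    (Phi : nat -> {poly R[i]}) (kappa : nat -> R) : Prop :=
  [/\ forall n, Phi n \is monic /\ size (Phi n) = n.+1,
      forall n, 0 < kappa n
    & forall n m, mu_integral b (fun t => (Phi n).[t] * ((Phi m).[t])^*)
                  = (kappa n ^- 2)%:C * (n == m)%:R].

(* Meaningful for z <> 0 only. *)
Definition Phistar (R : realType) (Phi : nat -> {poly R[i]}) (n : nat)
    (z : R[i]) : R[i] :=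
  z ^+ n * ((Phi n).[(z^*)^-1])^*.

Definition alpha (R : realType) (Phi : nat -> {poly R[i]}) (k : nat) : R[i] :=
  - ((Phi k.+1).[0])^*.

Definition bcoef (R : realType) (kappa : nat -> R) (n : nat) : R[i] :=
  (2 * pi * kappa n ^+ 2)%:C.

(* (1 / (2 pi i)) \int f(t) / (t - z) * nu(t) / t ^ n dt over the circle. *)
Definition cauchy_transform (R : realType) (b : R[i]) (n : nat)
    (f : R[i] -> R[i]) (z : R[i]) : R[i] :=
  (2 * pi%:C * 'i%C)^-1 *
  circle_integral (fun t => f t / (t - z) * (nu b t / t ^+ n)).

Definition G (R : realType) (b : R[i]) (Phi : nat -> {poly R[i]}) (n : nat) :
    R[i] -> R[i] :=
  cauchy_transform b n (fun t => (Phi n).[t]).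

(* [Gstar b Phi n] is G^*_{n-1}: the power of t in the kernel is n, not n-1. *)
Definition Gstar (R : realType) (b : R[i]) (Phi : nat -> {poly R[i]})
    (n : nat) : R[i] -> R[i] :=
  cauchy_transform b n (Phistar Phi n.-1).

Definition Y (R : realType) (b : R[i]) (Phi : nat -> {poly R[i]})
    (kappa : nat -> R) (n : nat) (z : R[i]) : 'M[R[i]]_2 :=
  mx2 (Phi n).[z]                              (G b Phi n z)
      (- bcoef kappa n.-1 * Phistar Phi n.-1 z) (- bcoef kappa n.-1 * Gstar b Phi n z).

Definition log_branch (R : realType) (g : R[i] -> R[i]) (z : R[i])
    (L : R[i] -> R[i]) : Prop :=
  holomorphic_near L z /\ eq_near (fun w => cexp (L w)) g z.

Definition sqrt_branch (R : realType) (g : R[i] -> R[i]) (z : R[i])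
    (s : R[i] -> R[i]) : Prop :=
  holomorphic_near s z /\ eq_near (fun w => s w ^+ 2) g z.

(* [v] is, near z, a holomorphic branch of the multivalued function
   (-w) ^ (- b^* ) * (1 - w) ^ (b + b^* ), i.e. of the continuation of [nu b]
   off the circle. *)
Definition nu_branch (R : realType) (b z : R[i]) (v : R[i] -> R[i]) : Prop :=
  exists L1 L2 : R[i] -> R[i],
    [/\ log_branch (fun w => - w) z L1,
        log_branch (fun w => 1 - w) z L2
      & eq_near v (fun w => cexp (- b^* * L1 w) * cexp ((b + b^*) * L2 w)) z].

(* [C] is, near z, diag (w ^ (-n/2) nu ^ (1/2), w ^ (n/2) nu ^ (-1/2)) for some
   choice of local branches [p] of w ^ (n/2) and [q] of nu ^ (1/2). *)
Definition C_branch (R : realType) (b : R[i]) (n : nat) (z : R[i])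
    (C : R[i] -> 'M[R[i]]_2) : Prop :=
  exists p v q : R[i] -> R[i],
    [/\ sqrt_branch (fun w => w ^+ n) z p,
        nu_branch b z v,
        sqrt_branch v z q
      & eq_near C (fun w => mx2 ((p w)^-1 * q w) 0 0 (p w * (q w)^-1)) z].

(* M = Z' Z^-1 with Z = Y C. *)
Definition Mmx (R : realType) (b : R[i]) (Phi : nat -> {poly R[i]})
    (kappa : nat -> R) (n : nat) (C : R[i] -> 'M[R[i]]_2) (z : R[i]) :
    'M[R[i]]_2 :=
  let Z := fun w => Y b Phi kappa n w *m C w in
  mx_cderive Z z *m invmx (Z z).

(* Main.v *)
(** Row by row, [M_n] has the asserted form exactly when four first-order
    differential equations hold, for [Phi_n], [Phi*_{n-1}] and their Cauchy
    transforms, together with [det Y_n = 1].  On the circle the weight satisfies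
    the Pearson equation [(1 - t) t nu' = - (b^* + b t) nu], and [(1 - t) nu]
    vanishes at [t = 1] because [lambda > -1/2]; integrating by parts turns it
    into a linear relation for the integrals of [h nu], [h] smooth on the circle.
    With [h = f t^-k], [f] a polynomial, orthogonality forces
    [(1 - t) Phi_n'] and [(1 - t) (Phi*_{n-1})'] to be combinations of [Phi_n],
    [Phi_{n-1}] and [Phi*_{n-1}], the coefficients being read off from the Szegő
    recurrence.  With [h = f t^(1-n) / (t - z)] it gives the equations for the
    Cauchy transforms.  The determinant is propagated by the Szegő recurrence. *)
Require Import Defs.
From mathcomp Require Import all_boot all_order all_algebra.
From mathcomp Require Import complex ring lra.
From mathcomp Require Import all_classical all_reals all_analysis measurable_realfun.
Set Implicit Arguments.
Unset Strict Implicit.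
Unset Printing Implicit Defensive.
Import Order.TTheory GRing.Theory Num.Theory.
Import numFieldNormedType.Exports.
Local Open Scope classical_set_scope.
Local Open Scope complex_scope.
Local Open Scope ring_scope.

(** * Orthogonal polynomials for a shift-invariant inner product *)

(** The algebra is carried out for functionals [ip] and [cau] known only through their shift rules;
    the integrals enter later, through proofs of these rules. Here [cau m p] stands for the integral
    of p(t) t^-m w / (t - z) over the angle. Since dt = i t dtheta cancels one power of the kernel
    t^-n, both G_n and G^*_{n-1} are, up to constants, [cau] with the same index m = n-1; hence the
    use of [n.+1] for the degree of the theorem.

    The weight is unbounded near t = 1 when lambda < 0, so integration by parts takes place on the
    open interval of angles, with limits at both ends. The factor 1 - t that kills these limits also
    cancels the pole of the logarithmic derivative of the weight. The branches in C_n enter only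
    through one scalar u with C_n = diag(u, 1/u), and only u'/u survives in M_n. *)

Definition revpoly (K : numClosedFieldType) (n : nat) (p : {poly K}) : {poly K} :=
  \poly_(i < n.+1) (p`_(n - i))^*.

(** Link with the formula of [Phistar], meaningful off 0 only; the polynomial form also has a value
    at 0 and a formal derivative. *)
Lemma horner_revpoly (K : numClosedFieldType) (n : nat) (p : {poly K}) (z : K) :
  z != 0 -> (size p <= n.+1)%N ->
  (revpoly n p).[z] = z ^+ n * (p.[(z^*)^-1])^*.
Proof.
move=> z0 sp; rewrite horner_poly (horner_coef_wide _ sp) rmorph_sum mulr_sumr.
rewrite (reindex_inj rev_ord_inj); apply: eq_bigr => i _ /=.
rewrite subSS subKn -1?ltnS// rmorphM rmorphXn /=.
have -> : ((z^*)^-1)^* = z^-1 by rewrite fmorphV /= conjCK.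
rewrite exprVn.
rewrite mulrCA; congr (_ * _).
have -> : z ^+ n = z ^+ (n - i) * z ^+ i by rewrite -exprD subnK// -ltnS.
by rewrite mulfK// expf_neq0.
Qed.

Section InnerProduct.
Variables (K : numClosedFieldType) (ip : {poly K} -> {poly K} -> K).
Hypotheses (ipDl : forall p q r, ip (p + q) r = ip p r + ip q r)
           (ipZl : forall c p r, ip (c%:P * p) r = c * ip p r)
           (ipC : forall p q, ip q p = (ip p q)^*)
           (ipX : forall p q, ip ('X * p) ('X * q) = ip p q).

Let ip0l r : ip 0 r = 0.
Proof. by have := ipZl 0 0 r; rewrite mulr0 mul0r. Qed.

Let ipNl p r : ip (- p) r = - ip p r.
Proof. by have := ipZl (-1) p r; rewrite polyCN mulN1r mulN1r. Qed.

Let ipBl p q r : ip (p - q) r = ip p r - ip q r.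
Proof. by rewrite ipDl ipNl. Qed.

Let ip_suml I (s : seq I) P F r :
  ip (\sum_(i <- s | P i) F i) r = \sum_(i <- s | P i) ip (F i) r.
Proof. by elim/big_rec2 : _ => [|i y1 y2 _ <-]; rewrite ?ip0l ?ipDl. Qed.

Let ip_sumr I (s : seq I) P F r :
  ip r (\sum_(i <- s | P i) F i) = \sum_(i <- s | P i) ip r (F i).
Proof. by rewrite ipC ip_suml rmorph_sum; apply: eq_bigr => i _; rewrite /= -ipC. Qed.

Let ipZr c p r : ip r (c%:P * p) = c^* * ip r p.
Proof. by rewrite ipC ipZl rmorphM /= -ipC. Qed.

Let ipDr p q r : ip r (p + q) = ip r p + ip r q.
Proof. by rewrite ipC ipDl rmorphD /= -!ipC. Qed.

Let ipBr p q r : ip r (p - q) = ip r p - ip r q.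
Proof. by rewrite ipC ipBl rmorphB /= -!ipC. Qed.

Let ip_eq0C p q : ip p q = 0 -> ip q p = 0.
Proof. by move=> pq; rewrite ipC pq rmorph0. Qed.

Let ipXn k p q : ip ('X^k * p) ('X^k * q) = ip p q.
Proof. by elim: k => [|k IH]; rewrite ?expr0 ?mul1r// exprS -!mulrA ipX. Qed.

(** Moments form a Toeplitz array: they depend only on the difference of the exponents, compared
    here without subtraction. Multiplying both arguments by a power of ['X] brings the two sides to
    the same pair. *)
Lemma ip_moment i j k l : (i + l = j + k)%N ->
  ip 'X^i 'X^k = ip 'X^j 'X^l.
Proof.
move=> e; rewrite -(ipXn l) -[RHS](ipXn k) -!exprD (addnC k l).
by rewrite (addnC l) e addnC.
Qed.

(** On the circle, t^n conj(p(t)) t^-k = t^(n-k) conj(p(t)); for an abstract [ip] this becomes a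
    comparison of moments, term by term. *)
Lemma ip_revpoly n (p : {poly K}) k : (size p <= n.+1)%N -> (k <= n)%N ->
  ip (revpoly n p) 'X^k = ip 'X^(n - k) p.
Proof.
move=> sp kn; rewrite /revpoly poly_def ip_suml.
rewrite -[in RHS](coefK p) poly_def (ip_sumr _ _ _ 'X^(n-k)).
rewrite (big_ord_widen n.+1 (fun i => ip 'X^(n - k) (p`_i *: 'X^i)) sp).
rewrite (reindex_inj rev_ord_inj) /= big_mkcond [RHS]big_mkcond /=.
apply: eq_bigr => i _; rewrite subSS subKn -1?ltnS// -!mul_polyC ipZl ipZr.
rewrite (@ip_moment (n - i) (n - k) k i); last by rewrite subnK -1?ltnS// subnK.
by case: ifPn => //; rewrite -leqNgt => /leq_sizeP->; rewrite // rmorph0 mul0r.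
Qed.

Variables (Phi : nat -> {poly K}) (kap : nat -> K).
Hypotheses (Phi_monic : forall n, Phi n \is monic)
           (size_Phi : forall n, size (Phi n) = n.+1)
           (kap_neq0 : forall n, kap n != 0)
           (ip_Phi : forall n m, ip (Phi n) (Phi m) = kap n * (n == m)%:R).

Let conj_kap n : (kap n)^* = kap n.
Proof.
have -> : kap n = ip (Phi n) (Phi n) by rewrite ip_Phi eqxx mulr1.
by rewrite -ipC.
Qed.

Lemma ip_Phi_lt n (q : {poly K}) : (size q <= n)%N -> ip (Phi n) q = 0.
Proof.
have [d] := ubnP (size q); elim: d q => // d IH q; rewrite ltnS => qd qn.
have [->|q0] := eqVneq q 0; first by rewrite ipC ip0l rmorph0.
have sq : (0 < size q)%N by rewrite size_poly_gt0.
pose r := q - (lead_coef q)%:P * Phi (size q).-1.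
have -> : q = (lead_coef q)%:P * Phi (size q).-1 + r by rewrite addrC subrK.
have sr : (size r < size q)%N.
  rewrite -[X in (_ < X)%N]prednK// ltnS; apply/leq_sizeP => j jq.
  rewrite coefB coefCM; move: jq; rewrite leq_eqVlt => /orP[/eqP <-|jq].
    have /monicP := Phi_monic (size q).-1; rewrite /lead_coef size_Phi/= => ->.
    by rewrite mulr1 subrr.
  rewrite [q`_j]nth_default 1?[(Phi _)`_j]nth_default ?size_Phi//.
    by rewrite mulr0 subrr.
  by rewrite -[X in (X <= _)%N]prednK.
rewrite ipDr ipZr ip_Phi (IH r); last 2 first.
- exact: leq_trans sr qd.
- exact: leq_trans (ltnW sr) qn.
rewrite gtn_eqF; first by rewrite !mulr0 addr0.
by rewrite prednK// (leq_trans _ qn).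
Qed.

Lemma ip_Phi_X n : ip (Phi n) 'X^n = kap n.
Proof.
have -> : 'X^n = Phi n - (Phi n - 'X^n) by rewrite opprB addrC subrK.
rewrite ipBr ip_Phi eqxx mulr1 ip_Phi_lt ?subr0//.
apply/leq_sizeP => j; rewrite leq_eqVlt => /orP[/eqP<-|nj].
  have /monicP := Phi_monic n; rewrite /lead_coef size_Phi/= => lc.
  by rewrite coefB coefXn eqxx lc subrr.
by rewrite coefB coefXn gtn_eqF// [_`_j]nth_default ?size_Phi// subrr.
Qed.

(** [kap_neq0] serves as definiteness: if q is nonzero of degree d, its pairing with [Phi d] is 0 by
    hypothesis, but also the leading coefficient of q times [kap d]. *)
Lemma orthogonal_eq0 m (q : {poly K}) : (size q <= m)%N ->
  (forall j, (j < m)%N -> ip q 'X^j = 0) -> q = 0.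
Proof.
move=> qm qX; apply/eqP; apply: contraT => q0.
have [d sd] : exists d, size q = d.+1.
  by exists (size q).-1; rewrite prednK// size_poly_gt0.
have : ip q (Phi d) = 0.
  rewrite -[Phi _]coefK poly_def ip_sumr big1// => -[j]/= + _.
  rewrite size_Phi => jq.
  by rewrite -mul_polyC ipZr qX ?mulr0// (leq_trans jq)// -sd.
rewrite -[X in ip X _]coefK poly_def ip_suml sd.
rewrite big_ord_recr/= big1 ?add0r => [|i _]; last first.
  by rewrite -mul_polyC ipZl (ip_eq0C (ip_Phi_lt _)) ?mulr0// size_polyXn.
rewrite -mul_polyC ipZl ipC ip_Phi_X conj_kap => /eqP.
rewrite mulf_eq0 (negPf (kap_neq0 _)) orbF.
have -> : d = (size q).-1 by rewrite sd.
by rewrite -lead_coefE lead_coef_eq0 (negPf q0).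
Qed.

(** This is how the structure relations get their coefficients: a degree bound, orthogonality and a
    single moment suffice. *)
Lemma orthogonal_eq_Phi m c (q : {poly K}) : (size q <= m.+1)%N ->
  (forall j, (j < m)%N -> ip q 'X^j = 0) -> ip q 'X^m = c * kap m ->
  q = c%:P * Phi m.
Proof.
move=> sq qX qm; apply/eqP; rewrite -subr_eq0; apply/eqP.
apply: (@orthogonal_eq0 m.+1) => [|j].
  rewrite (leq_trans (size_polyD _ _))// geq_max sq size_polyN.
  by rewrite mul_polyC (leq_trans (size_scale_leq _ _))// size_Phi.
rewrite ltnS leq_eqVlt ipBl ipZl => /orP[/eqP ->|jm].
  by rewrite qm ip_Phi_X subrr.
by rewrite qX// ip_Phi_lt ?size_polyXn// mulr0 subrr.
Qed.

(** * Szegő recurrences and norms *)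

Definition verblunsky n := - ((Phi n.+1).[0])^*.
Local Notation a := verblunsky.
Local Notation P n := (revpoly n (Phi n)).

Lemma ip_Phistar_gt0 n k : (0 < k <= n)%N -> ip (P n) 'X^k = 0.
Proof.
move=> /andP[k0 kn]; rewrite ip_revpoly ?size_Phi// ipC ip_Phi_lt ?rmorph0//.
by rewrite size_polyXn ltn_subrL k0 (leq_trans k0 kn).
Qed.

Lemma ip_Phistar0 n : ip (P n) 'X^0 = kap n.
Proof. by rewrite ip_revpoly ?size_Phi// subn0 ipC ip_Phi_X conj_kap. Qed.

Lemma horner_Phistar0 n : (P n).[0] = 1.
Proof.
rewrite horner_coef0 coef_poly ltn0Sn subn0.
have /monicP := Phi_monic n; rewrite /lead_coef size_Phi/= => ->.
by rewrite rmorph1.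
Qed.

Lemma size_Phistar n : (size (P n) <= n.+1)%N.
Proof. exact: size_poly. Qed.

Lemma Phi_lead_cancel n : (size (Phi n.+1 - 'X * Phi n)%R <= n.+1)%N.
Proof.
apply/leq_sizeP => j; rewrite leq_eqVlt coefB coefXM => /orP[/eqP<-/=|nj].
  have /monicP := Phi_monic n; rewrite /lead_coef size_Phi/= => ->.
  have /monicP := Phi_monic n.+1; rewrite /lead_coef size_Phi/= => ->.
  by rewrite subrr.
case: j nj => // j nj /=.
by rewrite !nth_default ?size_Phi ?subrr.
Qed.

(** The defect p has degree at most n, since leading terms cancel, and vanishes at 0 by the choice
    of [a n], so p = q X. Its three summands are orthogonal to X, ..., X^n; by shift invariance q,
    of degree below n, is orthogonal to 1, ..., X^(n-1), hence 0. *)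
Lemma szego_recurrence n : Phi n.+1 = 'X * Phi n - ((a n)^*)%:P * P n.
Proof.
apply/eqP; rewrite -subr_eq0; apply/eqP.
set p := (X in X = _).
have pE : p = (Phi n.+1 - 'X * Phi n) + ((a n)^*)%:P * P n.
  by rewrite /p opprB addrA addrAC.
have sp : (size p <= n.+1)%N.
  rewrite pE (leq_trans (size_polyD _ _))// geq_max Phi_lead_cancel.
  by rewrite mul_polyC (leq_trans (size_scale_leq _ _))// size_Phistar.
have p0 : p.[0] = 0.
  rewrite pE !hornerE horner_Phistar0 /verblunsky rmorphN /= conjCK.
  by ring.
have /factor_theorem [q pq] : root p 0 by apply/rootP.
move: pq; rewrite subr0 => pq.
suff -> : p = 0 by [].
suff q0 : q = 0 by rewrite pq q0 mul0r.
apply: (@orthogonal_eq0 n) => [|j jn].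
  have [->|q0] := eqVneq q 0; first by rewrite size_poly0.
  by move: sp; rewrite pq size_mulX// ltnS.
rewrite -ipX (mulrC 'X q) -pq -exprS pE !ipDl ipNl ipZl exprS ipX -exprS.
rewrite ip_Phistar_gt0 ?jn// mulr0.
by rewrite !ip_Phi_lt ?size_polyXn// oppr0 !addr0.
Qed.

Lemma szego_recurrence_star n : P n.+1 = P n - (a n)%:P * ('X * Phi n).
Proof.
apply/polyP => i; rewrite coefB coefCM coefXM !coef_poly.
rewrite szego_recurrence coefB coefCM coefXM coef_poly.
rewrite rmorphB rmorphM /= conjCK.
case: i => [|i] /=.
  by rewrite !subn0 ltnn /= conjC0 !mulr0 !subr0.
rewrite !subSS !ltnS.
have [ni|ni] := leqP i n; last first.
  by rewrite ltnNge (ltnW ni)/= nth_default ?mulr0 ?subr0// size_Phi.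
rewrite leq_subr subKn// conjCK subn_eq0 subnS.
by case: ltnP => _; rewrite ?conjC0.
Qed.

(** The first moment beyond the orthogonality range. Modulo X, ..., X^n, all orthogonal to [P n],
    the power X^(n+1) equals X [Phi n], which the recurrence splits into [Phi n.+1] and a multiple
    of [P n]. The square norm of [P n] is [kap n] because only its constant term 1 contributes. *)
Lemma ip_Phistar_top n : ip (P n) 'X^(n.+1) = a n * kap n.
Proof.
have -> : ip (P n) 'X^(n.+1) = ip (P n) ('X * Phi n).
  rewrite -[X in ip _ ('X * X)]coefK poly_def mulr_sumr ip_sumr size_Phi big_ord_recr/=.
  rewrite big1 ?add0r => [|i _]; last first.
    by rewrite -scalerAr -exprS -mul_polyC ipZr ip_Phistar_gt0 ?mulr0//= ltn_ord.
  have /monicP := Phi_monic n; rewrite /lead_coef size_Phi/= => ->.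
  by rewrite scale1r exprS.
have -> : 'X * Phi n = Phi n.+1 + ((a n)^*)%:P * P n.
  by rewrite szego_recurrence subrK.
rewrite ipDr ipZr conjCK (ip_eq0C (ip_Phi_lt (size_Phistar n))) add0r; congr (_ * _).
rewrite -[X in ip _ X]coefK poly_def ip_sumr.
rewrite (eq_bigr (fun i : 'I_(size (P n)) =>
    (if val i == 0%N then (kap n) else 0))); last first.
  move=> [[|i] il] _ /=; rewrite -mul_polyC ipZr.
    by rewrite ip_Phistar0 -horner_coef0 horner_Phistar0 rmorph1 mul1r.
  by rewrite ip_Phistar_gt0 ?mulr0//= -ltnS (leq_trans il)// size_Phistar.
have sP : (0 < size (P n))%N.
  rewrite size_poly_gt0; apply/eqP => P0.
  by have := horner_Phistar0 n; rewrite P0 horner0 => /eqP; rewrite eq_sym oner_eq0.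
by rewrite -big_mkcond/= (big_pred1 (Ordinal sP)) // => -[j].
Qed.

Lemma kap_recurrence n : kap n.+1 = (1 - a n * (a n)^*) * kap n.
Proof.
rewrite -[LHS]ip_Phi_X szego_recurrence ipBl ipZl exprS ipX -exprS ip_Phi_X.
by rewrite ip_Phistar_top; ring.
Qed.

(** * Structure relations from the Pearson equation *)

Variable b : K.
(** The angular derivative of (1 - t) f(t) t^-k w, divided by i, integrates to 0; pairing with
    ['X^k] supplies the factor t^-k. *)
Hypothesis pearson : forall f k,
  ip ('X * ((1 - 'X) * f^`()) - k%:R%:P * ((1 - 'X) * f) - 'X * f
      - ((b^*)%:P * f + b%:P * ('X * f))) 'X^k = 0.

(** [pearson] at k+1, so that shift invariance absorbs the factor ['X] in front of the derivative.
    Only two consecutive moments of f remain, so (1 - X) f' inherits almost all orthogonality of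
    f. *)
Let pearson_ip f k :
  ip ((1 - 'X) * f^`()) 'X^k =
  (k.+1%:R + b^*) * ip f 'X^(k.+1) + (b - k%:R) * ip f 'X^k.
Proof.
have := pearson f k.+1; rewrite !ipBl ipDl !ipZl exprS !ipX -exprS.
have -> : ip ((1 - 'X) * f) 'X^(k.+1) = ip f 'X^(k.+1) - ip f 'X^k.
  by rewrite [(1 - 'X) * f]mulrBl mul1r ipBl [in X in _ - X]exprS ipX.
move=> e.
apply/eqP; rewrite -subr_eq0 -e; apply/eqP; ring.
Qed.

Let size_1X (p : {poly K}) n : (size p <= n)%N -> (size ((1 - 'X) * p)%R <= n.+1)%N.
Proof.
move=> pn; rewrite mulrBl mul1r (leq_trans (size_polyD _ _))// geq_max.
rewrite (leq_trans pn)//= size_polyN mulrC.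
have [->|p0] := eqVneq p 0; first by rewrite mul0r size_poly0.
by rewrite size_mulX.
Qed.

Let size_deriv_le (p : {poly K}) n : (size p <= n.+1)%N -> (size p^`() <= n)%N.
Proof.
move=> pn; apply/leq_sizeP => j nj.
by rewrite coef_deriv nth_default ?mul0rn// (leq_trans pn).
Qed.

(** Adding (n+1) [Phi n.+1] cancels the leading coefficient. The sum has degree at most n, is
    orthogonal to lower powers, and its moment against X^n is (n+1 + conj b) [kap n.+1]. *)
Lemma Phi_structure n :
  (1 - 'X) * (Phi n.+1)^`() =
  ((n.+1%:R + b^*) * (1 - a n * (a n)^*))%:P * Phi n - n.+1%:R%:P * Phi n.+1.
Proof.
apply/eqP; rewrite eq_sym subr_eq eq_sym; apply/eqP.
apply: orthogonal_eq_Phi => [|j jn|].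
- apply/leq_sizeP => j; rewrite leq_eqVlt => /orP[/eqP<-|nj].
    rewrite coefD coefCM mulrBl mul1r coefB coefXM/= !coef_deriv.
    have /monicP := Phi_monic n.+1; rewrite /lead_coef size_Phi/= => ->.
    rewrite [(Phi _)`_ _]nth_default ?size_Phi//.
    by rewrite mul0rn sub0r mulr1 addrC subrr.
  rewrite nth_default// (leq_trans _ nj)// (leq_trans (size_polyD _ _))//.
  rewrite geq_max size_1X ?size_deriv_le ?size_Phi// mul_polyC.
  by rewrite (leq_trans (size_scale_leq _ _))// size_Phi.
- rewrite ipDl ipZl pearson_ip !ip_Phi_lt ?size_polyXn// 1?ltnW//.
  by rewrite !mulr0 !addr0.
- rewrite ipDl ipZl pearson_ip ip_Phi_X [ip _ 'X^n]ip_Phi_lt ?size_polyXn//.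
  by rewrite !mulr0 !addr0 kap_recurrence mulrA.
Qed.

(** Subtracting b [P n] turns the coefficient b - j of the j-th moment into - j, which removes the
    only nonzero moment, j = 0, below the top. The last one comes from [ip_Phistar_top]. *)
Lemma Phistar_structure n :
  (1 - 'X) * (P n)^`() =
  ((b^* + n.+1%:R) * a n)%:P * Phi n + b%:P * P n.
Proof.
apply/eqP; rewrite -subr_eq; apply/eqP.
apply: orthogonal_eq_Phi => [|j jn|].
- rewrite (leq_trans (size_polyD _ _))// geq_max size_polyN size_1X ?size_deriv_le ?size_Phistar//=.
  by rewrite mul_polyC (leq_trans (size_scale_leq _ _))// size_Phistar.
- rewrite ipBl ipZl pearson_ip (@ip_Phistar_gt0 n j.+1)//.
  case: j jn => [|j] jn; first by ring.
  by rewrite (@ip_Phistar_gt0 n j.+1) ?(ltnW jn)//; ring.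
- rewrite ipBl ipZl pearson_ip ip_Phistar_top.
  case: n => [|n]; first by ring.
  by rewrite (@ip_Phistar_gt0 n.+1 n.+1) ?leqnn//; ring.
Qed.

(** * Cauchy transforms: determinant and differential equations *)

Variables (z : K) (cau : nat -> {poly K} -> K).
(** [cauX] is t/(t - z) = 1 + z/(t - z) under the integral; [cauS] cancels a factor t against
    t^-(m+1). *)
Hypotheses (cauD : forall m p q, cau m (p + q) = cau m p + cau m q)
           (cauZ : forall m c p, cau m (c%:P * p) = c * cau m p)
           (cauX : forall m p, cau m ('X * p) = z * cau m p + ip p 'X^m)
           (cauS : forall m p, cau m.+1 ('X * p) = cau m p).

Let cauN m p : cau m (- p) = - cau m p.
Proof. by have := cauZ m (-1) p; rewrite polyCN mulN1r mulN1r. Qed.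

Let Phi0 : Phi 0%N = 1.
Proof.
have := size_Phi 0; have /monicP := Phi_monic 0 => + s1.
by rewrite (size1_polyC (eq_leq s1)) lead_coefC => ->.
Qed.

Let P0 : P 0%N = 1.
Proof.
by rewrite (size1_polyC (size_Phistar 0)) -horner_coef0 horner_Phistar0.
Qed.

Let PhiX n : 'X * Phi n = Phi n.+1 + ((a n)^*)%:P * P n.
Proof. by rewrite szego_recurrence subrK. Qed.

Lemma cauchy_determinant n :
  (Phi n.+1).[z] * cau n (P n) - (P n).[z] * cau n (Phi n.+1) = - kap n.
Proof.
elim: n => [|n IH].
  have -> : cau 0 (Phi 1) = z * cau 0 1 + kap 0 - (a 0)^* * cau 0 1.
    rewrite szego_recurrence P0 Phi0 cauD cauN cauZ cauX expr0.
    by rewrite -Phi0 ip_Phi eqxx mulr1.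
  have -> : (Phi 1).[z] = z - (a 0)^* by rewrite szego_recurrence P0 Phi0 !hornerE.
  by rewrite P0 hornerC; ring.
(* In this form the multiple of [Phi n.+1] drops out of the determinant, and 1 - |a n|^2 comes out
   as the factor of [kap_recurrence]. *)
have PS : P n.+1 = (1 - a n * (a n)^*)%:P * P n - (a n)%:P * Phi n.+1.
  rewrite szego_recurrence_star PhiX polyCB polyCM; ring.
(* Orthogonality of [P n.+1] to X^(n+1) removes the extra term of [cauX], so multiplying by z lowers
   the index of the transform. *)
have e1 : z * cau n.+1 (P n.+1) = cau n (P n.+1).
  have := cauX n.+1 (P n.+1).
  by rewrite ip_Phistar_gt0 ?leqnn// addr0 => <-; rewrite cauS.
have eP : (Phi n.+2).[z] = z * (Phi n.+1).[z] - (a n.+1)^* * (P n.+1).[z].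
  by rewrite szego_recurrence !hornerE.
have eC : cau n.+1 (Phi n.+2) = cau n (Phi n.+1) - (a n.+1)^* * cau n.+1 (P n.+1).
  by rewrite szego_recurrence cauD cauN cauZ cauS.
rewrite eP eC kap_recurrence.
transitivity ((Phi n.+1).[z] * (z * cau n.+1 (P n.+1)) - (P n.+1).[z] * cau n (Phi n.+1)).
  by ring.
rewrite e1 {e1 eP eC} PS cauD cauN !cauZ !hornerE -[RHS]mulrN -IH; ring.
Qed.

Variable dcau : nat -> {poly K} -> K.
Hypothesis cau_pearson : forall m f, z * (1 - z) * dcau m f =
  cau m ('X * ((1 - 'X) * f^`()) - m%:R%:P * ((1 - 'X) * f)
         - ((b^*)%:P * f + b%:P * ('X * f)) - (1 - z)%:P * f).

(** The structure relation leaves X [Phi n], rewritten in [Phi n.+1] and [P n], and X [Phi n.+1], on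
    which [cauX] produces the moment against X^n, which is 0. So the equation is homogeneous. *)
Lemma cauchy_Phi_ode n : z * (1 - z) * dcau n (Phi n.+1) =
  (- b * z - (b^* + n.+1%:R) * (a n * (a n)^*)) * cau n (Phi n.+1)
  + (1 - a n * (a n)^*) * (b^* + n.+1%:R) * (a n)^* * cau n (P n).
Proof.
rewrite cau_pearson.
set x := a n; set y := x^*.
pose c := (n.+1%:R + b^*) * (1 - x * y).
have -> : 'X * ((1 - 'X) * (Phi n.+1)^`()) =
    c%:P * (Phi n.+1 + y%:P * P n) - n.+1%:R%:P * ('X * Phi n.+1).
  by rewrite Phi_structure -PhiX /c; ring.
have -> : c%:P * (Phi n.+1 + y%:P * P n) - n.+1%:R%:P * ('X * Phi n.+1)
   - n%:R%:P * ((1 - 'X) * Phi n.+1) - ((b^*)%:P * Phi n.+1 + b%:P * ('X * Phi n.+1))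
   - (1 - z)%:P * Phi n.+1 =
   (c - n%:R - b^* - (1 - z))%:P * Phi n.+1 + (c * y)%:P * P n
   + (- 1 - b)%:P * ('X * Phi n.+1).
  by clearbody c; clearbody y; ring.
rewrite !cauD !cauZ cauX ip_Phi_lt ?size_polyXn// /c -natr1; ring.
Qed.

Lemma cauchy_Phistar_ode n : z * (1 - z) * dcau n (P n) =
  (b^* + n.+1%:R) * a n * cau n (Phi n.+1)
  + (n.+1%:R * z - (b^* + n.+1%:R) * (1 - a n * (a n)^*)) * cau n (P n).
Proof.
rewrite cau_pearson.
set x := a n; set y := x^*.
pose c := (b^* + n.+1%:R) * x.
have -> : 'X * ((1 - 'X) * (P n)^`()) =
    c%:P * (Phi n.+1 + y%:P * P n) + b%:P * ('X * P n).
  by rewrite Phistar_structure -PhiX /c; ring.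
have -> : c%:P * (Phi n.+1 + y%:P * P n) + b%:P * ('X * P n)
   - n%:R%:P * ((1 - 'X) * P n) - ((b^*)%:P * P n + b%:P * ('X * P n))
   - (1 - z)%:P * P n =
   c%:P * Phi n.+1 + (c * y - n%:R - b^* - (1 - z))%:P * P n
   + n%:R%:P * ('X * P n).
  by clearbody c; clearbody y; ring.
(* For n = 0 the moment is [kap 0], but its coefficient is 0. *)
have e0 : n%:R * ip (P n) 'X^n = 0.
  case: (posnP n) => [->|n0]; first by rewrite mul0r.
  by rewrite ip_Phistar_gt0 ?n0 ?leqnn ?mulr0.
rewrite !cauD !cauZ cauX mulrDr e0 /c -natr1; ring.
Qed.

Lemma Phi_ode n : z * (1 - z) * ((Phi n.+1)^`()).[z] =
  (- n.+1%:R * z + (b^* + n.+1%:R) * (1 - a n * (a n)^*)) * (Phi n.+1).[z]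
  + (1 - a n * (a n)^*) * (b^* + n.+1%:R) * (a n)^* * (P n).[z].
Proof.
have := congr1 (horner^~ z) (Phi_structure n); rewrite !hornerE => e.
have := congr1 (horner^~ z) (PhiX n); rewrite !hornerE => eP.
by rewrite -mulrA e mulrBr mulrCA eP; ring.
Qed.

Lemma Phistar_ode n : z * (1 - z) * ((P n)^`()).[z] =
  (b^* + n.+1%:R) * a n * (Phi n.+1).[z]
  + (b * z + (b^* + n.+1%:R) * (a n * (a n)^*)) * (P n).[z].
Proof.
have := congr1 (horner^~ z) (Phistar_structure n); rewrite !hornerE => e.
have := congr1 (horner^~ z) (PhiX n); rewrite !hornerE => eP.
have {eP} -> : (Phi n.+1).[z] = z * (Phi n).[z] - (a n)^* * (P n).[z].
  by rewrite eP addrK.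
by rewrite -[LHS]mulrA e /=; ring.
Qed.

End InnerProduct.

(** * Integration by parts on an open interval *)

(** The derivative f may blow up at the ends, so the fundamental theorem is applied on compact
    subintervals [x, y]. The indefinite integral G of the integrable f is continuous up to both
    ends, where it is compared with the limits of F. *)
Lemma Rintegral_oo_FTC0 (R : realType) (F f : R -> R) (a b : R) : a < b ->
  (forall x, a < x < b -> is_derive x 1 F (f x)) ->
  (forall x, a < x < b -> {for x, continuous f}) ->
  lebesgue_measure.-integrable `]a, b[ (EFin \o f) ->
  F x @[x --> a^'+] --> 0 -> F x @[x --> b^'-] --> 0 ->
  \int[lebesgue_measure]_(x in `]a, b[) f x = 0.
Proof.
move=> ab dF cf intf Fa Fb.
have intf' : lebesgue_measure.-integrable `[a, b] (EFin \o f).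
  have /integrableP[mf fi] := intf.
  have mf1 : measurable_fun `]a, b[ f by exact/measurable_EFinP.
  have mf2 := (measurable_fun_itv_bndo_bndcP _ _ _).1 mf1.
  have mf3 := (measurable_fun_itv_obnd_cbndP _ _ _).1 mf2.
  have mf' : measurable_fun `]a, b] (EFin \o f) by exact/measurable_EFinP.
  apply/integrableP; split; first exact/measurable_EFinP.
  rewrite -integral_itv_obnd_cbnd -?integral_itv_bndo_bndc//; exact: measurableT_comp.
pose G x := \int[lebesgue_measure]_(t in `[a, x]) f t.
have GB x y : a < x -> x < y -> y < b -> G y - G x = F y - F x.
  move=> ax xy yb; rewrite /G Rintegral_itvB//; last 3 first.
  - apply: integrableS intf' => //; apply: subset_itvl; rewrite bnd_simp; exact: ltW.
  - by rewrite bnd_simp ltW.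
  - by rewrite bnd_simp ltW.
  rewrite Rintegral_itv_obnd_cbnd; last first.
    apply: integrableS intf' => //; apply: subset_itv; rewrite bnd_simp; exact: ltW.
  have sub t : t \in `[x, y] -> a < t < b.
    by rewrite in_itv/= => /andP[xt ty]; rewrite (lt_le_trans ax)//= (le_lt_trans ty).
  have Fc t : t \in `[x, y] -> {for t, continuous F}.
    move=> /sub /dF [dft _]; exact/differentiable_continuous/derivable1_diffP.
  rewrite /Rintegral (continuous_FTC2 xy (F := F))//.
  - apply: continuous_in_subspaceT => t; rewrite inE => /sub; exact: cf.
  - split.
    + move=> t tI; have [] // := dF t _; apply: sub; exact: subset_itv_oo_cc tI.
    + by apply: cvg_at_right_filter; apply: Fc; rewrite in_itv/= lexx ltW.
    + by apply: cvg_at_left_filter; apply: Fc; rewrite in_itv/= lexx ltW.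
  - move=> t tI; rewrite derive1E; have [] // := dF t _; apply: sub; exact: subset_itv_oo_cc tI.
have G0 : G x @[x --> a^'+] --> 0.
  apply: cvg_at_right_filter; exact: parameterized_integral_cvg_left ab intf'.
(* G - F is constant on the open interval and tends to 0 at a. *)
have GF y : a < y < b -> G y = F y.
  move=> /andP[ay yb].
  have : (G y - F y) - (G x - F x) @[x --> a^'+] --> (G y - F y) - (0 - 0).
    apply: cvgB; [exact: cvg_cst|exact: cvgB].
  have : (G y - F y) - (G x - F x) @[x --> a^'+] --> 0.
    apply: (@cvg_trans _ ((fun=> 0 : R) @ a^'+)); last exact: cvg_cst.
    apply: near_eq_cvg; near=> x.
    have ax : a < x by near: x; exact: nbhs_right_gt.
    have xy : x < y by near: x; exact: nbhs_right_lt.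
    move: (GB _ _ ax xy yb); move: (G y) (G x) (F y) (F x) => ? ? ? ?; lra.
  move=> h1 h2; have e : 0 = G y - F y - (0 - 0).
    exact: (@cvg_unique R (@norm_hausdorff R R) _ _ _ _ h1 h2).
  by move: (G y) (F y) e => p q; lra.
have Gb : G x @[x --> b^'-] --> G b.
  exact: parameterized_integral_cvg_at_left.
have Gb0 : G x @[x --> b^'-] --> 0.
  apply: cvg_trans Fb; apply: near_eq_cvg; near=> x.
  rewrite GF//; apply/andP; split; near: x.
  - exact: nbhs_left_gt.
  - exact: nbhs_left_lt.
have <- : G b = 0 by exact: (@cvg_unique R (@norm_hausdorff R R) _ _ _ _ Gb Gb0).
rewrite /G -Rintegral_itv_obnd_cbnd ?Rintegral_itv_bndo_bndc//.
by apply: integrableS intf' => //; apply: subset_itvr; rewrite bnd_simp.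
Unshelve. all: by end_near. Qed.

(** * Complex derivatives *)

Definition has_cderive (K : numFieldType) (f : K -> K) (z d : K) : Prop :=
  is_derive z 1 f d.

Section NumFieldDerivative.
Variable K : numFieldType.
Implicit Types (f g : K -> K) (z a b c d : K).

Lemma has_cderiveE f z d : has_cderive f z d -> cderive f z = d.
Proof. by case=> _ <-; rewrite /cderive derive1E. Qed.

Lemma has_cderive_eq f z a b : has_cderive f z a -> a = b -> has_cderive f z b.
Proof. by move=> ? <-. Qed.

(* Unqualified, [eq_near] is a lemma of the filter library. *)
Lemma has_cderive_near f g z d : Defs.eq_near f g z ->
  has_cderive f z d -> has_cderive g z d.
Proof. by move=> fg df; apply: near_eq_is_derive df. Qed.

Lemma has_cderive_holomorphic f z :
  holomorphic_near f z -> has_cderive f z (cderive f z).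
Proof. by move=> /nbhs_singleton df; split=> //; rewrite /cderive derive1E. Qed.

Lemma has_cderive_cst c z : has_cderive (fun=> c) z 0.
Proof. exact: is_derive_cst. Qed.

Lemma has_cderive_id z : has_cderive id z 1.
Proof. exact: is_derive_id. Qed.

Lemma has_cderiveD f g z a b : has_cderive f z a -> has_cderive g z b ->
  has_cderive (fun w => f w + g w) z (a + b).
Proof. exact: is_deriveD. Qed.

Lemma has_cderiveN f z a : has_cderive f z a -> has_cderive (fun w => - f w) z (- a).
Proof. exact: is_deriveN. Qed.

Lemma has_cderiveM f g z a b : has_cderive f z a -> has_cderive g z b ->
  has_cderive (fun w => f w * g w) z (a * g z + f z * b).
Proof.
move=> df dg; have := is_deriveM df dg; rewrite /GRing.scale/= => h.
by apply: has_cderive_eq h _; rewrite addrC (mulrC (g z)).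
Qed.

Lemma has_cderiveZ c f z a : has_cderive f z a ->
  has_cderive (fun w => c * f w) z (c * a).
Proof.
move=> df; apply: has_cderive_eq (has_cderiveM (has_cderive_cst c z) df) _.
by rewrite mul0r add0r.
Qed.

Lemma has_cderiveX n f z a : has_cderive f z a ->
  has_cderive (fun w => f w ^+ n) z (n%:R * f z ^+ n.-1 * a).
Proof.
move=> df; have := is_deriveX n df; rewrite /GRing.scale/= => h.
by have -> : (fun w => f w ^+ n) = f ^+ n by apply/funext => w; rewrite fctE.
Qed.

(** An explicit quadratic remainder gives complex derivatives without power series or dominated
    convergence; it serves for the exponential and for differentiation under the integral. *)
Lemma has_cderive_quadratic f z d C e : 0 < e -> 0 <= C ->
  (forall h, `|h| < e -> `|f (z + h) - f z - h * d| <= C * `|h| ^+ 2) ->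
  has_cderive f z d.
Proof.
move=> e0 C0 fe.
have C1 : 0 < C + 1 by rewrite ltr_wpDl.
have lim : h^-1 *: (f (h *: 1 + z) - f z) @[h --> 0^'] --> d.
  apply/cvgrPdist_lt => eps eps0; near=> h.
  have h0 : h != 0 by near: h; exact: nbhs_dnbhs_neq.
  have he : `|h| < e by near: h; apply: dnbhs0_lt.
  have hC : `|h| < eps / (C + 1) by near: h; apply: dnbhs0_lt; rewrite divr_gt0.
  rewrite distrC /GRing.scale/= mulr1 (addrC h).
  have -> : h^-1 * (f (z + h) - f z) - d = h^-1 * (f (z + h) - f z - h * d) by field.
  rewrite normrM normfV mulrC ltr_pdivrMr ?normr_gt0//.
  apply: le_lt_trans (fe _ he) _.
  rewrite expr2 mulrA ltr_pM2r ?normr_gt0//.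
  move: hC; rewrite ltr_pdivlMr// mulrC; apply: le_lt_trans.
  by rewrite ler_wpM2r// lerDl.
split; first by apply/cvg_ex; exists d.
by apply/cvg_lim.
Unshelve. all: by end_near. Qed.

Lemma has_cderive_comp f g z a b :
  has_cderive f (g z) a -> has_cderive g z b -> has_cderive (fun w => f (g w)) z (a * b).
Proof.
move=> [df fa] [dg gb].
have Df : differentiable f (g z) by apply/derivable1_diffP.
have Dg : differentiable g z by apply/derivable1_diffP.
have Dfg : differentiable (f \o g) z by apply: differentiable_comp.
split; first by apply/derivable1_diffP.
have Eb : 'd f (g z) b = b *: 'd f (g z) 1.
  by rewrite -linearZ/= /GRing.scale/= mulr1.
by rewrite deriveE// diff_comp//= -[X in 'd f _ X]deriveE// gb Eb -deriveE// fa mulrC.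
Qed.

Lemma has_cderiveV f z d :
  f z != 0 -> has_cderive f z d -> has_cderive (fun w => (f w)^-1) z (- d / f z ^+ 2).
Proof.
move=> f0 [df fd]; split; first exact: derivableV.
by rewrite deriveV// fd /GRing.scale/= mulNr mulrC mulNr.
Qed.

Lemma has_cderive_horner (p : {poly K}) z : has_cderive (horner p) z p^`().[z].
Proof.
elim/poly_ind: p => [|p c dp].
  rewrite deriv0 horner0 (_ : horner 0 = cst 0); first exact: has_cderive_cst.
  by apply/funext => x; rewrite horner0.
have -> : horner (p * 'X + c%:P) = (fun w => p.[w] * w + c).
  by apply/funext => x; rewrite !hornerE.
apply: has_cderive_eq.
  by apply: has_cderiveD (has_cderive_cst c z); apply: has_cderiveM dp (has_cderive_id z).
by rewrite derivD derivC derivM derivX !hornerE /=; ring.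
Qed.

(** Differentiating E(L) = g, with E' = E, and dividing by E(L z) = g z determines L' whatever the
    branch. *)
Lemma has_cderive_log_branch (E L g : K -> K) z d :
  (forall w : K, has_cderive E w (E w)) -> holomorphic_near L z ->
  Defs.eq_near (fun w => E (L w)) g z -> g z != 0 -> has_cderive g z d ->
  has_cderive L z (d / g z).
Proof.
move=> dE /has_cderive_holomorphic dL Eg g0 /has_cderiveE dg.
apply: (has_cderive_eq dL).
have /has_cderiveE := has_cderive_near Eg (has_cderive_comp (dE (L z)) dL).
by rewrite dg (nbhs_singleton Eg) => ->; rewrite mulrAC mulfV// mul1r.
Qed.

Lemma has_cderive_sqrt_branch (s g : K -> K) z d :
  holomorphic_near s z -> Defs.eq_near (fun w => s w ^+ 2) g z -> g z != 0 ->
  has_cderive g z d -> has_cderive s z (s z * (d / g z) / 2).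
Proof.
move=> /has_cderive_holomorphic ds sg g0 /has_cderiveE dg.
apply: (has_cderive_eq ds).
have s0 : s z != 0.
  by apply: contraNneq g0 => sz; rewrite -(nbhs_singleton sg) sz expr0n.
have /has_cderiveE := has_cderive_near sg (has_cderiveX 2 ds).
by rewrite dg -(nbhs_singleton sg) => ->; rewrite expr1; field.
Qed.

End NumFieldDerivative.

(** * The complex exponential *)

Lemma MVT_origin (R : realType) (f f' : R -> R) :
  (forall x : R, is_derive x 1 f (f' x)) ->
  forall y, exists2 c, `|c| <= `|y| & f y - f 0 = f' c * y.
Proof.
move=> df y.
have cf a b : {within `[a, b], continuous f}.
  apply: continuous_subspaceT => x.
  by apply/differentiable_continuous/derivable1_diffP; case: (df x).
have [y0|y0|->] := ltgtP y 0; last by exists 0; rewrite ?subrr ?mulr0.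
- have [c] := MVT y0 (fun x _ => df x) (cf _ _).
  rewrite in_itv/= => /andP[yc c0] e; exists c; first by rewrite !ltr0_norm// lerN2 ltW.
  by rewrite -opprB e; ring.
- have [c] := MVT y0 (fun x _ => df x) (cf _ _).
  rewrite in_itv/= => /andP[yc c0] e; exists c; first by rewrite !gtr0_norm// ltW.
  by rewrite e; ring.
Qed.

Section RealEstimates.
Variable R : realType.
Implicit Types x y : R.

Lemma normr_sin_le y : `|sin y| <= `|y|.
Proof.
have [c _] := MVT_origin (@is_derive_sin R) y.
rewrite sin0 subr0 => ->; rewrite normrM ler_piMl//; exact: cos_max.
Qed.

Lemma normr_cosB1 y : `|cos y - 1| <= y ^+ 2.
Proof.
have [c cy] := MVT_origin (@is_derive_cos R) y.
rewrite cos0 => ->; rewrite normrM normrN -real_normK ?num_real// expr2.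
by rewrite ler_wpM2r// (le_trans (normr_sin_le c)).
Qed.

Lemma normr_sinB y : `|y| <= 1 -> `|sin y - y| <= y ^+ 2.
Proof.
move=> y1; have dF x : is_derive x 1 (fun y => sin y - y) (cos x - 1).
  by apply: is_deriveB.
have [c cy] := MVT_origin dF y.
rewrite sin0 !subr0 => ->; rewrite normrM -[X in _ <= X]real_normK ?num_real// expr2.
rewrite ler_wpM2r// (le_trans (normr_cosB1 c))// -real_normK ?num_real// expr2.
by rewrite (le_trans _ cy)// ler_piMl// (le_trans cy).
Qed.

(** From 1 - x <= exp(-x) one gets exp(x) (1 - x) <= 1, hence (exp(x) - 1 - x) (1 - x) <= x^2, and 1
    - x is at least 1/2. *)
Lemma normr_expRB1 x : `|x| <= 2^-1 -> `|expR x - 1 - x| <= 2 * x ^+ 2.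
Proof.
move=> x1; have := expR_ge1Dx x => h1; have := expR_ge1Dx (- x) => h2.
have x2 := ler_norm x. have x3 := lerNnormlW x1.
rewrite ger0_norm; last by rewrite -addrA -opprD subr_ge0.
have h3 : expR x * (1 - x) <= 1.
  by have := ler_wpM2l (expR_ge0 x) h2; rewrite expRxMexpNx_1.
have x4 : x <= 2^-1 by rewrite (le_trans x2).
rewrite -subr_ge0 in h1.
have h4 : (expR x - (1 + x)) * (1 - x) <= x ^+ 2 by move: h3; lra.
nra.
Qed.

End RealEstimates.

Section ComplexExponential.
Variable R : realType.
Implicit Types z w h : R[i].

Lemma cexpD z w : cexp (z + w) = cexp z * cexp w.
Proof.
case: z w => [a b] [c d]; apply/eqP; rewrite eq_complex /=.
rewrite !mul0r !subr0 !addr0 expRD cosD sinD.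
by apply/andP; split; apply/eqP; ring.
Qed.

Lemma normc_le_sum (x y : R) : `|x +i* y| <= (`|x| + `|y|)%:C.
Proof.
rewrite normc_def lecR /= -[leRHS]ger0_norm ?addr_ge0// -[leRHS]sqrtr_sqr.
rewrite ler_sqrt ?sqr_ge0// sqrrD !real_normK ?num_real//.
by rewrite lerD2r lerDl mulrn_wge0// mulr_ge0.
Qed.

Lemma normr_cexpB1 h : `|h| < 2^-1 -> `|cexp h - 1 - h| <= 5 * `|h| ^+ 2.
Proof.
case: h => x y hh.
have h4 : x ^+ 2 + y ^+ 2 <= 4^-1.
  rewrite -lecR; have /= -> := add_Re2_Im2 (x +i* y); rewrite rmorphV ?unitfE// rmorph_nat.
  have -> : 4^-1 = 2^-1 ^+ 2 :> R[i] by field.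
  by rewrite lerXn2r ?nnegrE// ltW.
have x0 := sqr_ge0 x; have y0 := sqr_ge0 y.
have xh : `|x| <= 2^-1 by rewrite ler_norml; apply/andP; split; nra.
have yh : `|y| <= 2^-1 by rewrite ler_norml; apply/andP; split; nra.
have e2 := normr_expRB1 xh.
have ex : expR x <= 2.
  have := ler_norm (expR x - 1 - x); have := lerNnormlW xh; have := ler_norm x.
  by lra.
have e1 : `|expR x - 1| <= 2 * `|x|.
  have -> : expR x - 1 = (expR x - 1 - x) + x by ring.
  apply: le_trans (ler_normD _ _) _.
  have : x ^+ 2 <= 2^-1 * `|x| by rewrite -real_normK ?num_real// expr2 ler_wpM2r.
  by move: e2; lra.
have c1 := normr_cosB1 y.
have s1 : `|sin y - y| <= y ^+ 2 by apply: normr_sinB; rewrite (le_trans yh)//; lra.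
have /= <- := add_Re2_Im2 (x +i* y).
(* The four terms are at most 2 y^2, 2 x^2, 2 y^2 and 2 |x| |y| <= x^2 + y^2; their sum 3 x^2 + 5
   y^2 explains the constant 5. *)
have -> : cexp (x +i* y) - 1 - (x +i* y) =
  (expR x * (cos y - 1) + (expR x - 1 - x)) +i*
  (expR x * (sin y - y) + (expR x - 1) * y).
  apply/eqP; rewrite eq_complex /=; apply/andP; split; apply/eqP; ring.
apply: le_trans (normc_le_sum _ _) _.
have -> : 5 * (x ^+ 2 + y ^+ 2)%:C = (5 * (x ^+ 2 + y ^+ 2))%:C :> R[i].
  by rewrite rmorphM rmorph_nat.
rewrite lecR.
apply: le_trans (lerD (ler_normD _ _) (ler_normD _ _)) _.
rewrite !normrM (ger0_norm (expR_ge0 x)).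
have m1 : expR x * `|cos y - 1| <= 2 * y ^+ 2 by apply: ler_pM => //; exact: expR_ge0.
have m2 : expR x * `|sin y - y| <= 2 * y ^+ 2 by apply: ler_pM => //; exact: expR_ge0.
have m3 : `|expR x - 1| * `|y| <= 2 * `|x| * `|y| by apply: ler_pM.
have m4 : 2 * `|x| * `|y| <= x ^+ 2 + y ^+ 2.
  rewrite -(real_normK (num_real x)) -(real_normK (num_real y)).
  by have := sqr_ge0 (`|x| - `|y|); lra.
by move: e2; lra.
Qed.

Lemma has_cderive_cexp z : has_cderive (@cexp R) z (cexp z).
Proof.
apply: (@has_cderive_quadratic _ _ _ _ (5 * `|cexp z|) 2^-1) => [||h hh].
- by rewrite invr_gt0.
- by rewrite mulr_ge0.
- have -> : cexp (z + h) - cexp z - h * cexp z = cexp z * (cexp h - 1 - h).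
    by rewrite cexpD; ring.
  rewrite normrM mulrAC (mulrC _ `|cexp z|) ler_wpM2l//.
  exact: normr_cexpB1.
Qed.

End ComplexExponential.

(** * Branches *)

Section Branches.
Variable R : realType.
Implicit Types (b z : R[i]).

Lemma cexp0 : cexp 0 = 1 :> R[i].
Proof. by apply/eqP; rewrite eq_complex /= expR0 cos0 sin0; apply/andP; split; apply/eqP; ring. Qed.

Lemma cexp_neq0 z : cexp z != 0.
Proof.
apply/eqP => z0; have := cexpD z (- z); rewrite z0 mul0r subrr cexp0 => /eqP.
by rewrite oner_eq0.
Qed.

Lemma nu_branch_has_cderive b z v : z != 0 -> 1 - z != 0 -> nu_branch b z v ->
  v z != 0 /\ has_cderive v z (v z * (- b^* / z - (b + b^*) / (1 - z))).
Proof.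
move=> z0 z1 [L1 [L2 [[hL1 eL1] [hL2 eL2] ev]]].
have nz0 : - z != 0 by rewrite oppr_eq0.
have dN : has_cderive (fun w : R[i] => - w) z (-1).
  exact: has_cderiveN (has_cderive_id z).
have dB : has_cderive (fun w : R[i] => 1 - w) z (0 - 1).
  exact: has_cderiveD (has_cderive_cst 1 z) dN.
have d1 := has_cderive_log_branch (@has_cderive_cexp R) hL1 eL1 nz0 dN.
have d2 := has_cderive_log_branch (@has_cderive_cexp R) hL2 eL2 z1 dB.
have e1 := has_cderive_comp (@has_cderive_cexp R _) (has_cderiveZ (- b^*) d1).
have e2 := has_cderive_comp (@has_cderive_cexp R _) (has_cderiveZ (b + b^*) d2).
have ve := nbhs_singleton ev.
split; first by rewrite ve mulf_neq0// cexp_neq0.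
have ev' : Defs.eq_near (fun w => cexp (- b^* * L1 w) * cexp ((b + b^*) * L2 w)) v z.
  by move: ev; apply: filterS => w ->.
apply: has_cderive_eq (has_cderive_near ev' (has_cderiveM e1 e2)) _.
rewrite ve; field.
by rewrite z0 z1.
Qed.

(** All branch choices are gathered in one nonvanishing scalar u, whose logarithmic derivative does
    not depend on them. *)
Lemma C_branch_diag b n z C : z != 0 -> 1 - z != 0 -> C_branch b n z C ->
  exists u, [/\ u z != 0,
    has_cderive u z (u z * (- (n%:R + b^*) / (2 * z) - (b + b^*) / (2 * (1 - z))))
    & Defs.eq_near C (fun w => mx2 (u w) 0 0 (u w)^-1) z].
Proof.
move=> z0 z1 [p [v [q [[hp ep] nv [hq eq] eC]]]].
have [v0 dv] := nu_branch_has_cderive z0 z1 nv.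
have zn0 : z ^+ n != 0 by rewrite expf_neq0.
have dp := has_cderive_sqrt_branch hp ep zn0 (has_cderiveX n (has_cderive_id z)).
have dq := has_cderive_sqrt_branch hq eq v0 dv.
have p0 : p z != 0.
  by apply: contraNneq zn0 => pz; rewrite -(nbhs_singleton ep) pz expr0n.
have q0 : q z != 0.
  by apply: contraNneq v0 => qz; rewrite -(nbhs_singleton eq) qz expr0n.
exists (fun w => (p w)^-1 * q w); split.
- by rewrite mulf_neq0// invr_eq0.
- apply: has_cderive_eq (has_cderiveM (has_cderiveV p0 dp) dq) _.
  (* For n = 0 the truncated exponent [n.-1] is harmless, since the factor n is 0. *)
  have -> : n%:R * z ^+ n.-1 * 1 / z ^+ n = n%:R / z.
    case: n {eC ep zn0 dp} => [|n]; first by rewrite !mul0r.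
    by rewrite /= exprS; field; rewrite z0 expf_neq0.
  move: (b^*) => c; field.
  by rewrite z0 z1 p0 v0.
- move: eC; apply: filterS => w ->.
  by rewrite invfM invrK.
Qed.

End Branches.

(** * Complex-valued functions of an angle *)

Section ComplexValued.
Variable R : realType.
Implicit Types (f g : R -> R[i]) (t : R).

Lemma cReM (x y : R[i]) : complex.Re (x * y) =
  complex.Re x * complex.Re y - complex.Im x * complex.Im y.
Proof. by case: x y => [a b] [c d]. Qed.

Lemma cImM (x y : R[i]) : complex.Im (x * y) =
  complex.Re x * complex.Im y + complex.Im x * complex.Re y.
Proof. by case: x y => [a b] [c d]. Qed.

Lemma cReD (x y : R[i]) : complex.Re (x + y) = complex.Re x + complex.Re y.
Proof. by case: x y => [a b] [c d]. Qed.

Lemma cImD (x y : R[i]) : complex.Im (x + y) = complex.Im x + complex.Im y.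
Proof. by case: x y => [a b] [c d]. Qed.

Lemma conj_complexE (x : R[i]) : x^* = complex.Re x +i* (- complex.Im x).
Proof. by case: x. Qed.

Lemma complex_eta (x : R[i]) : x = complex.Re x +i* complex.Im x.
Proof. by case: x. Qed.

(** Componentwise, as [cintegral] and the real fundamental theorem treat real and imaginary parts
    separately; [cderivative] follows the same pattern. *)
Definition ccontinuous f :=
  continuous (fun t => complex.Re (f t)) /\ continuous (fun t => complex.Im (f t)).

Lemma ccontinuous_cst c : ccontinuous (fun=> c).
Proof. by split=> t; exact: cvg_cst. Qed.

Lemma ccontinuousD f g : ccontinuous f -> ccontinuous g ->
  ccontinuous (fun t => f t + g t).
Proof.
move=> [f1 f2] [g1 g2]; split=> t.
- under eq_fun do rewrite cReD; apply: cvgD; [exact: f1|exact: g1].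
- under eq_fun do rewrite cImD; apply: cvgD; [exact: f2|exact: g2].
Qed.

Lemma ccontinuousM f g : ccontinuous f -> ccontinuous g ->
  ccontinuous (fun t => f t * g t).
Proof.
move=> [f1 f2] [g1 g2]; split=> t.
- under eq_fun do rewrite cReM.
  by apply: cvgB; apply: cvgM; [exact: f1|exact: g1|exact: f2|exact: g2].
- under eq_fun do rewrite cImM.
  by apply: cvgD; apply: cvgM; [exact: f1|exact: g2|exact: f2|exact: g1].
Qed.

Lemma ccontinuousJ f : ccontinuous f -> ccontinuous (fun t => (f t)^*).
Proof.
move=> [f1 f2]; split=> t; under eq_fun do rewrite conj_complexE /=; first exact: f1.
by apply: cvgN; exact: f2.
Qed.

Definition normsq (x : R[i]) := complex.Re x ^+ 2 + complex.Im x ^+ 2.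

Lemma normsq_neq0 x : x != 0 -> normsq x != 0.
Proof.
case: x => a b; rewrite eq_complex /normsq /= => ab.
by rewrite paddr_eq0 ?sqr_ge0// !sqrf_eq0.
Qed.

Lemma invcE (x : R[i]) : x^-1 =
  (complex.Re x / normsq x) +i* (- complex.Im x / normsq x).
Proof. by case: x => a b; rewrite mulNr. Qed.

Lemma ccontinuousV f : ccontinuous f -> (forall t, f t != 0) ->
  ccontinuous (fun t => (f t)^-1).
Proof.
move=> [f1 f2] f0.
have c t : {for t, continuous (fun t => (normsq (f t))^-1)}.
  apply: cvgV; first by rewrite normsq_neq0.
  by apply: cvgD; rewrite /=; apply: cvgM; [exact: f1|exact: f1|exact: f2|exact: f2].
split=> t; under eq_fun do rewrite invcE /=.
- by apply: cvgM; [exact: f1|exact: c].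
- by apply: cvgM; [apply: cvgN; exact: f2|exact: c].
Qed.

Lemma ccontinuousX f n : ccontinuous f -> ccontinuous (fun t => f t ^+ n).
Proof.
move=> cf; elim: n => [|n IH].
  by under eq_fun do rewrite expr0; exact: ccontinuous_cst.
by under eq_fun do rewrite exprS; exact: ccontinuousM.
Qed.

Lemma ccontinuous_horner f (p : {poly R[i]}) : ccontinuous f ->
  ccontinuous (fun t => p.[f t]).
Proof.
move=> cf; elim/poly_ind: p => [|p c IH].
  by under eq_fun do rewrite horner0; exact: ccontinuous_cst.
under eq_fun do rewrite !hornerE.
by apply: ccontinuousD (ccontinuous_cst c); exact: ccontinuousM.
Qed.

Definition cderivative f f' := forall t,
  is_derive t 1 (fun t => complex.Re (f t)) (complex.Re (f' t)) /\
  is_derive t 1 (fun t => complex.Im (f t)) (complex.Im (f' t)).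

Lemma cderivative_eq f f' g : cderivative f f' -> f' =1 g -> cderivative f g.
Proof. by move=> df /funext <-. Qed.

Lemma cderivative_cst c : cderivative (fun=> c) (fun=> 0).
Proof. by move=> t; split; exact: is_derive_cst. Qed.

Lemma cderivativeD f f' g g' : cderivative f f' -> cderivative g g' ->
  cderivative (fun t => f t + g t) (fun t => f' t + g' t).
Proof.
move=> df dg t; case: (df t) (dg t) => [f1 f2] [g1 g2].
split; rewrite ?cReD ?cImD.
- by under eq_fun do rewrite cReD; exact: is_deriveD.
- by under eq_fun do rewrite cImD; exact: is_deriveD.
Qed.

Lemma cderivativeM f f' g g' : cderivative f f' -> cderivative g g' ->
  cderivative (fun t => f t * g t) (fun t => f' t * g t + f t * g' t).
Proof.
move=> df dg t; case: (df t) (dg t) => [f1 f2] [g1 g2]; split.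
- under eq_fun do rewrite cReM.
  apply: is_derive_eq (is_deriveB (is_deriveM f1 g1) (is_deriveM f2 g2)) _.
  by rewrite cReD !cReM /GRing.scale/=; ring.
- under eq_fun do rewrite cImM.
  apply: is_derive_eq (is_deriveD (is_deriveM f1 g2) (is_deriveM f2 g1)) _.
  by rewrite cImD !cImM /GRing.scale/=; ring.
Qed.

Lemma cderivativeV f f' : cderivative f f' -> (forall t, f t != 0) ->
  cderivative (fun t => (f t)^-1) (fun t => - f' t / f t ^+ 2).
Proof.
move=> df f0 t; case: (df t) => f1 f2.
have n0 := normsq_neq0 (f0 t).
have dn : is_derive t 1 (fun t => normsq (f t))
   (2 * complex.Re (f t) * complex.Re (f' t) + 2 * complex.Im (f t) * complex.Im (f' t)).
  apply: is_derive_eq (is_deriveD (is_deriveX 2 f1) (is_deriveX 2 f2)) _.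
  by rewrite /GRing.scale/=; ring.
have dV := @is_deriveV R (fun t => normsq (f t)) t _ 1 n0 dn.
have e : - f' t / f t ^+ 2 = - f' t * ((f t)^-1 * (f t)^-1).
  by rewrite -exprVn expr2.
split; under eq_fun do rewrite invcE /=.
- apply: is_derive_eq (is_deriveM f1 dV) _.
  rewrite e !(cReM, cImM) invcE /GRing.scale/=.
  move: n0; rewrite /normsq; case: (f t) (f' t) => [x y] [z w] /= n0; field.
  done.
- have f2' : is_derive t 1 (fun t => - complex.Im (f t)) (- complex.Im (f' t)).
    exact: is_deriveN.
  apply: is_derive_eq (is_deriveM f2' dV) _.
  rewrite e !(cReM, cImM) invcE /GRing.scale/=.
  move: n0; rewrite /normsq; case: (f t) (f' t) => [x y] [z w] /= n0. field.
  done.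
Qed.

Definition circ (t : R) : R[i] := cexp (0 +i* t).

Lemma circE t : circ t = cos t +i* sin t.
Proof. by rewrite /circ /cexp /= expR0 mul1r. Qed.

Lemma circ_conjV t : (circ t)^* = (circ t)^-1.
Proof. by rewrite circE invcE /normsq/= cos2Dsin2 !divr1. Qed.

Lemma circ_neq0 t : circ t != 0.
Proof.
rewrite circE eq_complex /= -[in X in ~~ X](sqrf_eq0 (cos t)) -(sqrf_eq0 (sin t)).
by rewrite -paddr_eq0 ?sqr_ge0// cos2Dsin2 oner_eq0.
Qed.

Lemma norm_circ t : `|circ t| = 1.
Proof. by rewrite circE normc_def /= cos2Dsin2 sqrtr1. Qed.

Lemma ccontinuous_circ : ccontinuous circ.
Proof.
split; under eq_fun do rewrite circE /=; [exact: continuous_cos|exact: continuous_sin].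
Qed.

Lemma cderivative_circ : cderivative circ (fun t => 'i%C * circ t).
Proof.
move=> t; have -> : 'i%C * circ t = - sin t +i* cos t.
  by rewrite circE; apply/eqP; rewrite eq_complex /=; apply/andP; split; apply/eqP; ring.
split; under eq_fun do rewrite circE /=; [exact: is_derive_cos|exact: is_derive_sin].
Qed.

(** Negative powers t^-k appear as powers of the conjugate, the form produced by pairing with
    ['X^k]. *)
Lemma cderivative_conj_circX k :
  cderivative (fun t => (circ t)^* ^+ k) (fun t => - 'i%C * k%:R * (circ t)^* ^+ k).
Proof.
have d1 : cderivative (fun t => (circ t)^*) (fun t => - 'i%C * (circ t)^*).
  under eq_fun do rewrite circ_conjV.
  apply: cderivative_eq (cderivativeV cderivative_circ circ_neq0) _ => t.
  by rewrite circ_conjV; field; exact: circ_neq0.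
elim: k => [|k IH].
  under eq_fun do rewrite expr0.
  by apply: cderivative_eq (cderivative_cst 1) _ => t; rewrite mulr0 mul0r.
under eq_fun do rewrite exprS.
apply: cderivative_eq (cderivativeM d1 IH) _ => t.
by rewrite exprS -natr1; ring.
Qed.

Lemma cderivative_horner f f' (p : {poly R[i]}) : cderivative f f' ->
  cderivative (fun t => p.[f t]) (fun t => p^`().[f t] * f' t).
Proof.
move=> df; elim/poly_ind: p => [|p c IH].
  under eq_fun do rewrite horner0.
  by apply: cderivative_eq (cderivative_cst 0) _ => t; rewrite deriv0 horner0 mul0r.
under eq_fun do rewrite !hornerE.
apply: cderivative_eq (cderivativeD (cderivativeM IH df) (cderivative_cst c)) _ => t.
by rewrite derivD derivC derivM derivX !hornerE /=; ring.
Qed.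

End ComplexValued.

(** * Weighted integrals and Cauchy transforms *)

Lemma normc_ge_Im (R : rcfType) (x : R[i]) : `|complex.Im x|%:C <= `|x|.
Proof.
by rewrite normc_def lecR -sqrtr_sqr ler_sqrt ?addr_ge0 ?sqr_ge0// lerDr sqr_ge0.
Qed.

Lemma continuous_bounded_oo (R : realType) (a b : R) (g : R -> R) :
  continuous g -> exists M, forall t, t \in `]a, b[ -> `|g t| <= M.
Proof.
move=> cg; have cI : {within `[a, b], continuous g} by exact: continuous_subspaceT.
have /compact_bounded[M [Mr HM]] := continuous_compact cI (@segment_compact R a b).
exists (M + 1) => t It; apply: HM; first by rewrite ltrDl.
by exists t => //; exact: subset_itv_oo_cc It.
Qed.

Lemma ccontinuous_bounded_oo (R : realType) (a b : R) (g : R -> R[i]) :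
  ccontinuous g -> exists2 M, 0 <= M & forall t, t \in `]a, b[ -> `|g t| <= M%:C.
Proof.
move=> [g1 g2]; have [M1 h1] := continuous_bounded_oo a b g1.
have [M2 h2] := continuous_bounded_oo a b g2.
exists (`|M1| + `|M2|); first by rewrite addr_ge0.
move=> t It; rewrite (complex_eta (g t)) (le_trans (normc_le_sum _ _))// lecR.
by apply: lerD; [apply: le_trans (h1 t It) _|apply: le_trans (h2 t It) _]; rewrite ler_norm.
Qed.

Lemma eq_cintegral (R : realType) (D : set R) (f g : R -> R[i]) :
  {in D, f =1 g} -> cintegral D f = cintegral D g.
Proof.
by move=> fg; rewrite /cintegral; congr (_ +i* _); apply: eq_Rintegral => t tI; rewrite fg.
Qed.

Section WeightedIntegral.
Variables (R : realType) (w : R -> R).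
Let I : set R := `]0, 2 * pi[.
Let mu := (@lebesgue_measure R).
Hypothesis iw : mu.-integrable I (EFin \o w).

Definition wint (f : R -> R[i]) : R[i] := cintegral I (fun t => f t * (w t)%:C).

Let mI : measurable (I : set (measurableTypeR R)). Proof. exact: measurable_itv. Qed.

Lemma continuous_integrable_weight (g : R -> R) : continuous g ->
  mu.-integrable I (EFin \o (fun t => g t * w t)).
Proof.
move=> cg.
have mg : measurable_fun (I : set (measurableTypeR R)) g.
  by apply: measurable_funS (continuous_measurable_fun cg).
have bg : [bounded g x | x in I].
  have [M HM] := continuous_bounded_oo 0 (2 * pi) cg.
  exists M; split; first exact: num_real.
  by move=> x Mx t /= It; rewrite (le_trans _ (ltW Mx))// HM.
exact: (integrableMr mI mg bg iw).
Qed.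

Lemma wintE f : wint f =
  (\int[mu]_(t in I) (complex.Re (f t) * w t)) +i*
  (\int[mu]_(t in I) (complex.Im (f t) * w t)).
Proof.
rewrite /wint /cintegral -/mu; congr (_ +i* _); apply: eq_Rintegral => t _.
- by rewrite cReM /= mulr0 subr0.
- by rewrite cImM /= mulr0 add0r.
Qed.

Lemma eq_wint f g : {in I, f =1 g} -> wint f = wint g.
Proof. by move=> fg; apply: eq_cintegral => t tI; rewrite fg. Qed.

Lemma wintD f g : ccontinuous f -> ccontinuous g ->
  wint (fun t => f t + g t) = wint f + wint g.
Proof.
move=> [f1 f2] [g1 g2]; rewrite !wintE; apply/eqP; rewrite eq_complex /=.
by rewrite -!RintegralD//; try exact: continuous_integrable_weight;
  apply/andP; split; apply/eqP; apply: eq_Rintegral => t _; rewrite ?cReD ?cImD mulrDl.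
Qed.

Lemma wintZ c f : ccontinuous f -> wint (fun t => c * f t) = c * wint f.
Proof.
move=> [f1 f2]; rewrite !wintE; apply/eqP; rewrite eq_complex cReM cImM /=.
have i1 := continuous_integrable_weight f1.
have i2 := continuous_integrable_weight f2.
have j1 r : mu.-integrable I (EFin \o (fun t => r * (complex.Re (f t) * w t))).
  exact: (integrableZl mI r i1).
have j2 r : mu.-integrable I (EFin \o (fun t => r * (complex.Im (f t) * w t))).
  exact: (integrableZl mI r i2).
rewrite -!RintegralZl// -RintegralB// -RintegralD//.
apply/andP; split; apply/eqP; apply: eq_Rintegral => t _; rewrite ?cReM ?cImM; ring.
Qed.

Lemma wintJ f : ccontinuous f -> wint (fun t => (f t)^*) = (wint f)^*.
Proof.
move=> [f1 f2]; rewrite !wintE conj_complexE /=; apply/eqP; rewrite eq_complex /=.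
have i2 := continuous_integrable_weight f2.
rewrite -[X in _ && (_ == X)]mulN1r -RintegralZl//.
apply/andP; split; apply/eqP; apply: eq_Rintegral => t _; rewrite conj_complexE //=.
by rewrite mulN1r mulNr.
Qed.

Hypothesis w_ge0 : forall t, 0 <= w t.

(** The factor 2 comes from bounding real and imaginary parts separately. *)
Lemma wint_bound f (M : R) : ccontinuous f -> (forall t, t \in I -> `|f t| <= M%:C) ->
  `|wint f| <= (2 * M * \int[mu]_(t in I) w t)%:C.
Proof.
move=> [f1 f2] fM; rewrite wintE.
have bnd (g : R -> R) : continuous g -> (forall t, t \in I -> `|g t| <= M) ->
    `|\int[mu]_(t in I) (g t * w t)| <= M * \int[mu]_(t in I) w t.
  move=> cg gM; have ig := continuous_integrable_weight cg.
  apply: le_trans (le_normr_Rintegral mI ig) _.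
  rewrite -RintegralZl//; apply: le_Rintegral => //.
  - exact: integrable_norm ig.
  - exact: (integrableZl mI M iw).
  - by move=> t It; rewrite normrM (ger0_norm (w_ge0 t)) ler_wpM2r// gM// inE.
apply: le_trans (normc_le_sum _ _) _; rewrite lecR -mulrA mulr_natl mulr2n.
apply: lerD; apply: bnd => // t It; rewrite -lecR.
- exact: le_trans (normc_ge_Re _) (fM t It).
- exact: le_trans (normc_ge_Im _) (fM t It).
Qed.

Lemma ccontinuous_cauchy (g : R -> R[i]) (z : R[i]) :
  ccontinuous g -> (forall t, circ t - z != 0) ->
  ccontinuous (fun t => g t / (circ t - z)).
Proof.
move=> cg z0; apply: ccontinuousM => //; apply: ccontinuousV => //.
apply: ccontinuousD (ccontinuous_cst _); exact: ccontinuous_circ.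
Qed.

(** Expanding 1/(t - z - h) = 1/(t - z) + h/(t - z)^2 + h^2/((t - z)^2 (t - z - h)) makes the
    remainder explicit; it is quadratic in h once the denominators are bounded below. *)
Lemma has_cderive_cauchy (g : R -> R[i]) (z : R[i]) : ccontinuous g -> `|z| != 1 ->
  has_cderive (fun u => wint (fun t => g t / (circ t - u))) z
              (wint (fun t => g t / (circ t - z) / (circ t - z))).
Proof.
move=> cg z1.
pose r := complex.Re `|z|; have zr : `|z| = r%:C.
  by rewrite /r RRe_real// normr_real.
(* Half the distance from z to the circle: for |h| < d every denominator keeps modulus at least d,
   whence the constant M / d^3. *)
pose d := `|1 - r| / 2.
have d0 : 0 < d.
  rewrite divr_gt0// normr_gt0 subr_eq0; apply: contraNneq z1 => r1.
  by rewrite zr -r1.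
have zd t : (2 * d)%:C <= `|circ t - z|.
  have := ler_dist_dist (circ t) z; rewrite norm_circ zr.
  apply: le_trans; rewrite /d mulrC divfK//.
  have -> : 1 - r%:C = (1 - r)%:C by rewrite rmorphB.
  by rewrite normc_def lecR /= expr0n addr0 sqrtr_sqr.
have zhd h t : `|h| < d%:C -> d%:C <= `|circ t - (z + h)|.
  move=> hd; rewrite opprD addrA; apply: le_trans (lerB_dist _ _).
  rewrite lerBrDr (le_trans _ (zd t))// mulr_natl mulr2n rmorphD lerD2l.
  exact: ltW.
have nz (u : R[i]) e : 0 < e -> e%:C <= `|u| -> u != 0.
  move=> e0 eu; rewrite -normr_gt0 (lt_le_trans _ eu)// ltcR.
  by [].
have [M M0 gM] := ccontinuous_bounded_oo 0 (2 * pi) cg.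
have z0 t : circ t - z != 0 by apply: nz (zd t); rewrite mulr_gt0.
pose W := \int[mu]_(t in I) w t.
have W0 : 0 <= W by apply: Rintegral_ge0.
apply: (@has_cderive_quadratic _ _ _ _ (2 * (M / d ^+ 3) * W)%:C d%:C).
- by rewrite ltcR.
- by rewrite lecR !mulr_ge0// invr_ge0 exprn_ge0// ltW.
move=> h hd; have zh0 t : circ t - (z + h) != 0 by exact: nz (zhd _ _ hd).
have c1 := ccontinuous_cauchy cg z0.
have c2 := ccontinuous_cauchy c1 z0.
have c3 := ccontinuous_cauchy cg zh0.
have c4 := ccontinuous_cauchy c2 zh0.
have -> : wint (fun t => g t / (circ t - (z + h))) - wint (fun t => g t / (circ t - z))
    - h * wint (fun t => g t / (circ t - z) / (circ t - z)) =
  h ^+ 2 * wint (fun t => g t / (circ t - z) / (circ t - z) / (circ t - (z + h))).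
  have -> : wint (fun t => g t / (circ t - (z + h))) = wint (fun t => g t / (circ t - z)) +
      (h * wint (fun t => g t / (circ t - z) / (circ t - z)) +
       h ^+ 2 * wint (fun t => g t / (circ t - z) / (circ t - z) / (circ t - (z + h)))).
    have c5 := ccontinuousM (ccontinuous_cst h) c2.
    have c6 := ccontinuousM (ccontinuous_cst (h ^+ 2)) c4.
    rewrite -(wintZ h c2) -(wintZ (h ^+ 2) c4) -(wintD c5 c6) -(wintD c1 (ccontinuousD c5 c6)).
    apply: eq_wint => t _.
    by move: (z0 t) (zh0 t); move: (circ t) (g t) => x y x0 xh0; field; rewrite x0 xh0.
  by ring.
rewrite normrM normrX mulrC ler_wpM2r ?exprn_ge0//.
apply: wint_bound => // t It; rewrite !normrM !normfV.
have n1 : `|circ t - z|^-1 <= (d^-1)%:C.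
  rewrite rmorphV ?unitfE ?gt_eqF// lef_pV2 ?posrE ?normr_gt0 ?ltcR//.
  apply: le_trans (zd t); rewrite lecR mulr_natl mulr2n lerDl; exact: ltW.
have n2 : `|circ t - (z + h)|^-1 <= (d^-1)%:C.
  rewrite rmorphV ?unitfE ?gt_eqF// lef_pV2 ?posrE ?normr_gt0 ?ltcR//.
  exact: zhd.
have -> : (M / d ^+ 3)%:C = M%:C * (d^-1)%:C * (d^-1)%:C * (d^-1)%:C.
  by rewrite -exprVn !exprS expr0 mulr1 !mulrA !rmorphM.
do 3 (apply: ler_pM; rewrite ?mulr_ge0 ?invr_ge0 ?normr_ge0 //).
by apply: gM; move: It; rewrite inE.
Qed.

End WeightedIntegral.

(** * The weight *)

Lemma powR_comp_cvg0 (R : realType) (T : Type) (F : set_system T) (s : T -> R) (p : R) :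
  Filter F -> 0 < p -> (\forall t \near F, 0 < s t) -> s @ F --> 0 ->
  s t `^ p @[t --> F] --> 0.
Proof.
move=> FF p0 sgt scvg; apply: (@cvg_comp _ _ _ s (fun x => x `^ p) F 0^'+); last exact: powR_cvg0.
move=> A [e /= e0 eA]; near=> t; apply: eA.
- rewrite /ball_ /= distrC subr0.
  by near: t; exact: cvgr0_norm_lt s scvg e e0.
- by near: t.
Unshelve. all: by end_near. Qed.

Section Weight.
Variables (R : realType) (lam eta : R).
Implicit Types t : R.

(** The weight exp(-eta (t - pi)) (2 sin(t/2))^(2 lam) in the angle, as a single exponential: it is
    nonnegative and measurable on the whole line, whatever [ln] returns at arguments that are not
    positive. *)
Definition wt t := expR (- eta * (t - pi) + 2 * lam * ln (2 * sin (t / 2))).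

Lemma wt_ge0 t : 0 <= wt t. Proof. exact: expR_ge0. Qed.

Lemma measurable_wt : measurable_fun [set: measurableTypeR R] wt.
Proof.
apply: measurableT_comp => //; apply: measurable_funD.
  apply: continuous_measurable_fun => t.
  by apply: cvgM; [exact: cvg_cst|apply: cvgB; [exact: cvg_id|exact: cvg_cst]].
apply: measurable_funM => //; apply: measurableT_comp; first exact: measurable_ln.
apply: continuous_measurable_fun => t.
apply: cvgM; first exact: cvg_cst.
apply: (@continuous_comp _ _ _ (fun t => t / 2) sin); last exact: continuous_sin.
by apply: cvgM; [exact: cvg_id|exact: cvg_cst].
Qed.

(** An infinite integral is turned into 0 by [Rintegral], so a nonzero value proves finiteness for
    this nonnegative function. *)
Lemma integrable_wt : \int[lebesgue_measure]_(t in `]0, 2 * pi[) wt t != 0 ->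
  lebesgue_measure.-integrable `]0, 2 * pi[ (EFin \o wt).
Proof.
move=> w0.
have mw : measurable_fun (`]0, 2 * pi[ : set (measurableTypeR R)) wt.
  exact: measurable_funS measurable_wt.
apply/integrableP; split; first exact/measurable_EFinP.
under eq_integral => t _ do rewrite /= ger0_norm ?wt_ge0//.
rewrite ltey; apply: contraNneq w0; rewrite /Rintegral => ->.
by [].
Qed.

Lemma sin_half_gt0 t : 0 < t < 2 * pi -> 0 < sin (t / 2).
Proof. by move=> t2; apply: sin_gt0_pi; lra. Qed.

Lemma is_derive_wt t : 0 < t < 2 * pi ->
  is_derive t 1 wt (wt t * (- eta + lam * (cos (t / 2) / sin (t / 2)))).
Proof.
move=> tI; have s0 := sin_half_gt0 tI.
have d1 : is_derive t (1 : R) (fun t => t / 2) (1 / 2).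
  have -> : (fun t : R => t / 2) = (2^-1 : R) *: id.
    by apply/funext => x; rewrite fctE /GRing.scale/= mulrC.
  by apply: is_derive_eq; rewrite /GRing.scale/= mulrC.
have d2 : is_derive t (1 : R) (fun t => 2 * sin (t / 2)) (cos (t / 2)).
  have d2 := @is_derive1_comp R sin (fun t => t / 2) t _ _ (is_derive_sin (t / 2)) d1.
  apply: is_derive_eq (is_deriveZ 2 d2) _.
  by rewrite /GRing.scale/=; field.
have d3 : is_derive t (1 : R) (fun t => ln (2 * sin (t / 2)))
    ((2 * sin (t / 2))^-1 * cos (t / 2)).
  apply: (@is_derive1_comp R (@ln R) (fun t => 2 * sin (t / 2)) t _ _ _ d2).
  by apply: is_derive1_ln; rewrite mulr_gt0.
have d4 : is_derive t (1 : R) (fun t => - eta * (t - pi)) (- eta).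
  apply: is_derive_eq (is_deriveZ (- eta) (is_deriveB (is_derive_id t 1) (is_derive_cst pi t 1))) _.
  by rewrite subr0 /GRing.scale/= mulr1.
have d5 := is_deriveD d4 (is_deriveZ (2 * lam) d3).
apply: is_derive_eq (is_derive1_comp (is_derive_expR _) d5) _.
rewrite /wt /GRing.scale/=; congr (_ * _).
by field; rewrite gt_eqF.
Qed.

(** The product is a bounded exponential times (2 sin(t/2))^(2 lam + 1), and 2 lam + 1 > 0. The
    filter is left abstract to cover both ends of the interval. *)
Lemma wt_boundary (F : set_system R) : Filter F -> - 2^-1 < lam ->
  (\forall t \near F, 0 < t < 2 * pi) ->
  2 * sin (t / 2) @[t --> F] --> 0 -> 2 * sin (t / 2) * wt t @[t --> F] --> 0.
Proof.
move=> FF hl FI Fs.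
have sp : (2 * sin (t / 2)) `^ (2 * lam + 1) @[t --> F] --> 0.
  apply: powR_comp_cvg0 => //; first lra.
  by near=> t; rewrite mulr_gt0// sin_half_gt0//; near: t.
(* Bound of exp(-eta (t - pi)), as |t - pi| <= pi. *)
pose E := expR (`|eta| * pi).
have sE : E * (2 * sin (t / 2)) `^ (2 * lam + 1) @[t --> F] --> 0.
  by rewrite -(mulr0 E); apply: cvgM => //; exact: cvg_cst.
apply: (squeeze_cvgr _ (cvg_cst 0) sE).
near=> t; have tI : 0 < t < 2 * pi by near: t.
have s0 := sin_half_gt0 tI.
have s20 : 0 < 2 * sin (t / 2) by rewrite mulr_gt0.
rewrite mulr_ge0 ?wt_ge0 ?(ltW s20)//=.
have -> : 2 * sin (t / 2) * wt t =
    expR (- eta * (t - pi)) * (2 * sin (t / 2)) `^ (2 * lam + 1).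
  rewrite /powR gt_eqF// /wt expRD -{1}(lnK s20) mulrCA; congr (_ * _).
  rewrite -expRD; congr expR.
  by ring.
apply: ler_pM; rewrite ?expR_ge0 ?powR_ge0//.
rewrite ler_expR (le_trans (ler_norm _))// normrM normrN ler_wpM2l// ler_norml; lra.
Unshelve. all: by end_near. Qed.

End Weight.

(** * Values of [nu] on the circle and the Pearson equation *)

Lemma cln_polar (R : realType) (r phi : R) : 0 < r -> - pi < phi < pi ->
  cln ((r * cos phi) +i* (r * sin phi)) = ln r +i* phi.
Proof.
move=> r0 /andP[phi1 phi2].
have cm : cmod ((r * cos phi) +i* (r * sin phi)) = r.
  rewrite /cmod normc_def /= !exprMn -mulrDr cos2Dsin2 mulr1 sqrtr_sqr.
  by rewrite gtr0_norm.
rewrite /cln /carg cm /= mulrAC mulfV ?gt_eqF// mul1r pmulr_rge0//.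
have [phi0|phi0] := leP 0 phi.
  rewrite sin_ge0_pi ?phi0 ?(ltW phi2)// cosK//.
  by rewrite in_itv/= phi0 (ltW phi2).
have -> : (0 <= sin phi) = false.
  apply/negbTE; rewrite -ltNge -oppr_gt0 -sinN sin_gt0_pi//.
  by apply/andP; split; [rewrite oppr_gt0|rewrite ltrNl].
by rewrite cosKN ?opprK// (ltW phi1) ltW.
Qed.

Section PearsonEquation.
Variables (R : realType) (lam eta : R).
Implicit Types t : R.
Let b : R[i] := lam +i* eta.
Local Notation wt := (wt lam eta).

Lemma circ_half t : circ t = (cos (t / 2) +i* sin (t / 2)) ^+ 2.
Proof.
rewrite circE [in LHS](_ : t = (t / 2) *+ 2); last by rewrite -mulr_natr; field.
rewrite cos_mulr2n sin_mulr2n; apply/eqP; rewrite eq_complex expr2 /=.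
have := cos2Dsin2 (t / 2); move: (cos _) (sin _) => c s cs.
by apply/andP; split; apply/eqP; [lra|ring].
Qed.

Lemma subr_circ_half t : 1 - circ t =
  - 'i%C * (2 * sin (t / 2))%:C * (cos (t / 2) +i* sin (t / 2)).
Proof.
rewrite circ_half expr2; have := cos2Dsin2 (t / 2); move: (cos _) (sin _) => c s cs.
apply/eqP; rewrite eq_complex /=; apply/andP; split; apply/eqP; [lra|ring].
Qed.

Lemma norm_subr_circ t : 0 < t < 2 * pi -> `|1 - circ t| = (2 * sin (t / 2))%:C.
Proof.
move=> tI; have s0 := sin_half_gt0 tI.
rewrite subr_circ_half !normrM normrN !normc_def /= cos2Dsin2 expr0n /= add0r.
rewrite expr1n sqrtr1 mul1r mulr1 addr0 sqrtr_sqr gtr0_norm// mulr_gt0//.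
Qed.

(** Here -e^(it) = e^(i(t - pi)) and 1 - e^(it) = 2 sin(t/2) e^(i(t - pi)/2), with arguments inside
    ]-pi, pi[, so principal logarithms are explicit. The imaginary parts -lam (t - pi) and lam (t -
    pi) of the exponent cancel. *)
Lemma nu_circ t : 0 < t < 2 * pi -> nu b (circ t) = (wt t)%:C.
Proof.
move=> tI; have s0 := sin_half_gt0 tI.
have l1 : cln (- circ t) = 0 +i* (t - pi).
  rewrite -ln1 -(@cln_polar R 1 (t - pi))//; last lra.
  congr cln; rewrite circE !mul1r -[in LHS](subrK pi t) cosDpi sinDpi.
  by apply/eqP; rewrite eq_complex /= !opprK !eqxx.
have l2 : cln (1 - circ t) = ln (2 * sin (t / 2)) +i* ((t - pi) / 2).
  rewrite -cln_polar ?mulr_gt0//; last by apply/andP; split; lra.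
  congr cln; rewrite subr_circ_half mulrBl cosBpihalf sinBpihalf.
  by apply/eqP; rewrite eq_complex /=; apply/andP; split; apply/eqP; ring.
rewrite /nu /cpow l1 l2 -cexpD /b conj_complexE /=.
set u := (X in cexp X).
have -> : u = (- eta * (t - pi) + 2 * lam * ln (2 * sin (t / 2))) +i* 0.
  by apply/eqP; rewrite eq_complex /=; apply/andP; split; apply/eqP; field.
by rewrite /cexp /= cos0 sin0 mulr1.
Qed.

(* The logarithmic derivative of the weight is [- i (b^* + b t) / (1 - t)], [t] on the circle. *)
Lemma weight_log_derivative t : 0 < t < 2 * pi ->
  (1 - circ t) * (- eta + lam * (cos (t / 2) / sin (t / 2)))%:C =
  - 'i%C * (b^* + b * circ t).
Proof.
move=> tI; have s0 := sin_half_gt0 tI.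
rewrite subr_circ_half circ_half /b conj_complexE.
have -> : (- eta + lam * (cos (t / 2) / sin (t / 2)))%:C =
    (- eta * sin (t / 2) + lam * cos (t / 2))%:C / (sin (t / 2))%:C.
  by rewrite -fmorphV -rmorphM; congr (_%:C); field; rewrite gt_eqF.
have s1 : (sin (t / 2))%:C != 0 by rewrite eq_complex /= eqxx andbT gt_eqF.
have -> : (2 * sin (t / 2))%:C = 2 * (sin (t / 2))%:C by rewrite rmorphM rmorph_nat.
transitivity (- 'i%C * 2 * (- eta * sin (t / 2) + lam * cos (t / 2))%:C *
   (cos (t / 2) +i* sin (t / 2))); first by field.
have := cos2Dsin2 (t / 2); move: (cos _) (sin _) => c s cs; rewrite expr2.
(* The Pythagorean identity is supplied already multiplied by eta and lam, so that the goals become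
   linear in the monomials. *)
have h1 : eta * (c ^+ 2 + s ^+ 2) = eta by rewrite cs mulr1.
have h2 : lam * (c ^+ 2 + s ^+ 2) = lam by rewrite cs mulr1.
apply/eqP; rewrite eq_complex /=; apply/andP; split; apply/eqP; lra.
Qed.

Hypothesis iw : lebesgue_measure.-integrable `]0, 2 * pi[ (EFin \o wt).

(** The integrand, weight included, is the angular derivative of (1 - t) f w, which tends to 0 at
    both ends because f is bounded. *)
Lemma wint_pearson f f' : - 2^-1 < lam ->
  cderivative f f' -> ccontinuous f -> ccontinuous f' ->
  wint wt (fun t => (1 - circ t) * f' t - 'i%C * circ t * f t
                    - 'i%C * (b^* + b * circ t) * f t) = 0.
Proof.
move=> hl df cf cf'.
pose U t := (1 - circ t) * f t.
pose H t := (1 - circ t) * f' t - 'i%C * circ t * f t - 'i%C * (b^* + b * circ t) * f t.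
have cc := ccontinuous_circ R.
have cN (g : R -> R[i]) : ccontinuous g -> ccontinuous (fun t => - g t).
  by move=> cg; under eq_fun do rewrite -mulN1r; exact: ccontinuousM (ccontinuous_cst _) cg.
have c1 : ccontinuous (fun t => 1 - circ t).
  by apply: ccontinuousD (ccontinuous_cst _) _; exact: cN.
have cb : ccontinuous (fun t => b^* + b * circ t).
  by apply: ccontinuousD (ccontinuous_cst _) _; apply: ccontinuousM (ccontinuous_cst _) _.
have cH : ccontinuous H.
  apply: ccontinuousD; first apply: ccontinuousD.
  - exact: ccontinuousM.
  - by apply: cN; apply: ccontinuousM => //; apply: ccontinuousM (ccontinuous_cst _) _.
  - by apply: cN; apply: ccontinuousM => //; apply: ccontinuousM (ccontinuous_cst _) _.
have dU : cderivative U (fun t => - ('i%C * circ t) * f t + (1 - circ t) * f' t).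
  apply: cderivativeM df; apply: cderivative_eq.
    apply: cderivativeD (cderivative_cst 1) _.
    have := cderivativeM (cderivative_cst (-1)) (cderivative_circ (R := R)).
    by under eq_fun do rewrite mulN1r; exact.
  by move=> t /=; rewrite mul0r !add0r mulN1r.
have dUw t : 0 < t < 2 * pi ->
    is_derive t 1 (fun t => complex.Re (U t) * wt t) (complex.Re (H t) * wt t) /\
    is_derive t 1 (fun t => complex.Im (U t) * wt t) (complex.Im (H t) * wt t).
  move=> tI; have [d1 d2] := dU t; have dw := is_derive_wt lam eta tI.
  (* The factor 1 - t of U cancels the pole of the logarithmic derivative of the weight. *)
  have HE : H t = (- ('i%C * circ t) * f t + (1 - circ t) * f' t) +
      U t * (- eta + lam * (cos (t / 2) / sin (t / 2)))%:C.
    by rewrite /U mulrAC weight_log_derivative// /H; ring.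
  split.
  - apply: is_derive_eq (is_deriveM d1 dw) _.
    rewrite HE (cReD _ (U t * _)) (cReM (U t)) /GRing.scale/=.
    by move: (complex.Re (_ + _)) => r; ring.
  - apply: is_derive_eq (is_deriveM d2 dw) _.
    rewrite HE (cImD _ (U t * _)) (cImM (U t)) /GRing.scale/=.
    by move: (complex.Im (_ + _)) => r; ring.
have wc t : 0 < t < 2 * pi -> {for t, continuous wt}.
  move=> tI; apply/differentiable_continuous/derivable1_diffP.
  by case: (is_derive_wt lam eta tI).
have [M M0 fM] := ccontinuous_bounded_oo 0 (2 * pi) cf.
(* Serves for the real and imaginary parts of U at both ends: |1 - t| equals 2 sin of the
   half-angle. *)
have bd (F : set_system R) (g : R -> R) : Filter F ->
    (forall t, 0 < t < 2 * pi -> `|g t| <= 2 * sin (t / 2) * M) ->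
    (\forall t \near F, 0 < t < 2 * pi) -> 2 * sin (t / 2) @[t --> F] --> 0 ->
    g t * wt t @[t --> F] --> 0.
  move=> FF gM FI Fs.
  have s0 := wt_boundary eta FF hl FI Fs.
  have s1 : M * (2 * sin (t / 2) * wt t) @[t --> F] --> 0.
    by rewrite -(mulr0 M); apply: cvgM => //; exact: cvg_cst.
  have s2 : - (M * (2 * sin (t / 2) * wt t)) @[t --> F] --> 0.
    by rewrite -oppr0; exact: cvgN.
  apply: (squeeze_cvgr _ s2 s1); near=> t.
  rewrite -ler_norml normrM (ger0_norm (wt_ge0 _ _ _)) mulrCA mulrA ler_wpM2r ?wt_ge0//.
  by rewrite gM//; near: t.
have UM t : 0 < t < 2 * pi -> `|U t| <= (2 * sin (t / 2) * M)%:C.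
  move=> tI; rewrite normrM norm_subr_circ//.
  have -> : (2 * sin (t / 2) * M)%:C = (2 * sin (t / 2))%:C * M%:C by rewrite rmorphM.
  apply: ler_wpM2l.
    by rewrite lecR mulr_ge0// ltW// sin_half_gt0.
  by apply: fM; rewrite in_itv.
have pi2 : (0 : R) < 2 * pi by rewrite mulr_gt0// pi_gt0.
have sinc (x : R) : {for x, continuous (fun t => 2 * sin (t / 2))}.
  apply: cvgM; first exact: cvg_cst.
  apply: (@continuous_comp _ _ _ (fun t => t / 2) sin); last exact: continuous_sin.
  by apply: cvgM; [exact: cvg_id|exact: cvg_cst].
have sl : 2 * sin (t / 2) @[t --> (0 : R)^'+] --> 0.
  have := cvg_at_right_filter (sinc 0).
  by rewrite mul0r sin0 mulr0.
have sr : 2 * sin (t / 2) @[t --> (2 * pi : R)^'-] --> 0.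
  have := cvg_at_left_filter (sinc (2 * pi)).
  by rewrite mulrAC divff// mul1r sinpi mulr0.
have Il : \forall t \near (0 : R)^'+, 0 < t < 2 * pi.
  near=> t; apply/andP; split; near: t; [exact: nbhs_right_gt|exact: nbhs_right_lt].
have Ir : \forall t \near (2 * pi : R)^'-, 0 < t < 2 * pi.
  near=> t; apply/andP; split; near: t; [exact: nbhs_left_gt|exact: nbhs_left_lt].
have [H1 H2] := cH.
rewrite wintE; apply/eqP; rewrite eq_complex /=; apply/andP; split; apply/eqP.
- apply: (Rintegral_oo_FTC0 pi2 (F := fun t => complex.Re (U t) * wt t)).
  + by move=> t /dUw[].
  + by move=> t tI; apply: cvgM; [exact: H1|exact: wc].
  + exact: continuous_integrable_weight.
  + apply: bd => // t tI; rewrite -lecR; apply: le_trans (UM t tI); exact: normc_ge_Re.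
  + apply: bd => // t tI; rewrite -lecR; apply: le_trans (UM t tI); exact: normc_ge_Re.
- apply: (Rintegral_oo_FTC0 pi2 (F := fun t => complex.Im (U t) * wt t)).
  + by move=> t /dUw[].
  + by move=> t tI; apply: cvgM; [exact: H2|exact: wc].
  + exact: continuous_integrable_weight.
  + apply: bd => // t tI; rewrite -lecR; apply: le_trans (UM t tI); exact: normc_ge_Im.
  + apply: bd => // t tI; rewrite -lecR; apply: le_trans (UM t tI); exact: normc_ge_Im.
Unshelve. all: by end_near. Qed.

End PearsonEquation.

(** * Inner product and Cauchy transform of the weight *)

Section WeightInnerProduct.
Variables (R : realType) (lam eta : R).
Let b : R[i] := lam +i* eta.
Local Notation wt := (wt lam eta).

Lemma circle_integral_nu (f : R[i] -> R[i]) :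
  circle_integral (fun t => f t * nu b t) = wint wt (fun t => f (circ t) * ('i%C * circ t)).
Proof.
apply: eq_cintegral => t; rewrite inE/= in_itv/= => tI.
by rewrite -/(circ t) nu_circ// mulrAC.
Qed.

Lemma mu_integral_wint f : mu_integral b f = wint wt (fun t => f (circ t)).
Proof.
rewrite /mu_integral; have -> : (fun t => f t * (nu b t / ('i%C * t))) =
    (fun t => f t / ('i%C * t) * nu b t) by apply/funext => t; rewrite mulrA mulrAC.
rewrite circle_integral_nu; apply: eq_wint => t _.
by rewrite divfK// mulf_neq0 ?circ_neq0// eq_complex /= oner_eq0 andbF.
Qed.

Hypothesis iw : lebesgue_measure.-integrable `]0, 2 * pi[ (EFin \o wt).

Definition wip (p q : {poly R[i]}) : R[i] :=
  wint wt (fun t => p.[circ t] * (q.[circ t])^*).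

Let hE := (@hornerD, @hornerN, @hornerM, @hornerX, @hornerC).

Let chorner (p : {poly R[i]}) : ccontinuous (fun t => p.[circ t]).
Proof. by apply: ccontinuous_horner; exact: ccontinuous_circ. Qed.

Let cip (p q : {poly R[i]}) : ccontinuous (fun t => p.[circ t] * (q.[circ t])^*).
Proof. by apply: ccontinuousM (chorner p) _; apply: ccontinuousJ; exact: chorner. Qed.

Lemma wipDl (p q r : {poly R[i]}) : wip (p + q) r = wip p r + wip q r.
Proof.
rewrite /wip -wintD//; apply: eq_wint => t _.
by rewrite hornerD mulrDl.
Qed.

Lemma wipZl c p r : wip (c%:P * p) r = c * wip p r.
Proof.
rewrite /wip -wintZ//; apply: eq_wint => t _.
by rewrite hornerCM mulrA.
Qed.

Lemma wipC p q : wip q p = (wip p q)^*.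
Proof.
rewrite /wip -wintJ//; apply: eq_wint => t _.
by rewrite rmorphM /= conjCK mulrC.
Qed.

Lemma wipX p q : wip ('X * p) ('X * q) = wip p q.
Proof.
apply: eq_wint => t _; rewrite !hornerM hornerX rmorphM /= circ_conjV.
by have := circ_neq0 t; move: (circ t) (_^*) => x y x0; field.
Qed.

Definition wcau (z : R[i]) (m : nat) (p : {poly R[i]}) : R[i] :=
  wint wt (fun t => p.[circ t] * (circ t)^* ^+ m / (circ t - z)).

Definition dwcau (z : R[i]) (m : nat) (p : {poly R[i]}) : R[i] :=
  wint wt (fun t => p.[circ t] * (circ t)^* ^+ m / (circ t - z) / (circ t - z)).

Let cpm (p : {poly R[i]}) m : ccontinuous (fun t => p.[circ t] * (circ t)^* ^+ m).
Proof.
apply: ccontinuousM (chorner p) _; apply: ccontinuousX; apply: ccontinuousJ.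
exact: ccontinuous_circ.
Qed.

Lemma has_cderive_wcau z m p : `|z| != 1 ->
  has_cderive (fun u => wcau u m p) z (dwcau z m p).
Proof. by move=> z1; apply: has_cderive_cauchy => //; exact: wt_ge0. Qed.

Hypothesis hlam : - 2^-1 < lam.

Let i_neq0 : 'i%C != 0 :> R[i].
Proof. by rewrite eq_complex /= oner_eq0 andbF. Qed.

Let cpm_derivative (p : {poly R[i]}) k :
  cderivative (fun t => p.[circ t] * (circ t)^* ^+ k)
    (fun t => 'i%C * ((('X * p^`() - k%:R%:P * p).[circ t]) * (circ t)^* ^+ k)).
Proof.
have d1 := cderivative_horner p (@cderivative_circ R).
have d2 := @cderivative_conj_circX R k.
apply: cderivative_eq (cderivativeM d1 d2) _ => t.
by rewrite !hE /=; ring.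
Qed.

Lemma wip_pearson f k :
  wip ('X * ((1 - 'X) * f^`()) - k%:R%:P * ((1 - 'X) * f) - 'X * f
      - ((b^*)%:P * f + b%:P * ('X * f))) 'X^k = 0.
Proof.
have cd := ccontinuousM (ccontinuous_cst 'i%C) (cpm ('X * f^`() - k%:R%:P * f) k).
have := wint_pearson iw hlam (cpm_derivative f k) (cpm f k) cd; rewrite -/b.
set q := (X in wip X _) => e.
apply: (mulfI i_neq0); rewrite mulr0 -e -wintZ//; apply: eq_wint => t _.
by rewrite /q hornerXn rmorphXn !hE /=; ring.
Qed.

Variable z : R[i].
Hypothesis z1 : `|z| != 1.

Lemma circ_subr_neq0 t : circ t - z != 0.
Proof. by rewrite subr_eq0; apply: contraNneq z1 => <-; rewrite norm_circ. Qed.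

Let ccau (p : {poly R[i]}) m : ccontinuous (fun t => p.[circ t] * (circ t)^* ^+ m / (circ t - z)).
Proof. by apply: ccontinuous_cauchy => //; exact: circ_subr_neq0. Qed.

Lemma wcauD m p q : wcau z m (p + q) = wcau z m p + wcau z m q.
Proof.
rewrite /wcau -wintD//; apply: eq_wint => t _.
by rewrite hornerD !mulrDl.
Qed.

Lemma wcauZ m c p : wcau z m (c%:P * p) = c * wcau z m p.
Proof.
rewrite /wcau -wintZ//; apply: eq_wint => t _.
by rewrite hornerCM !mulrA.
Qed.

Lemma wcauX m p : wcau z m ('X * p) = z * wcau z m p + wip p 'X^m.
Proof.
rewrite /wcau /wip -wintZ// -wintD//; last first.
  by apply: ccontinuousM (ccontinuous_cst _) _.
apply: eq_wint => t _; rewrite !hE hornerXn rmorphXn /=.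
by have := circ_subr_neq0 t; move: (circ t) (_^* ^+ _) => x y x0; field.
Qed.

Lemma wcauS m p : wcau z m.+1 ('X * p) = wcau z m p.
Proof.
apply: eq_wint => t _; rewrite !hE exprS circ_conjV.
have := circ_subr_neq0 t; have := circ_neq0 t.
by move: (_^-1 ^+ m); move: (circ t) => x y x0 x1; field; rewrite x0 x1.
Qed.

(** Integration by parts with f t^-m / (t - z). The derivative of 1/(t - z) gives -t (1 - t)/(t -
    z)^2, and t (1 - t) = z (1 - z) + (t - z)(1 - t - z) splits off the double pole; the rest
    combines with - t f into - (1 - z) f. *)
Lemma wcau_pearson m f : z * (1 - z) * dwcau z m f =
  wcau z m ('X * ((1 - 'X) * f^`()) - m%:R%:P * ((1 - 'X) * f)
         - ((b^*)%:P * f + b%:P * ('X * f)) - (1 - z)%:P * f).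
Proof.
set q := (X in wcau z m X).
have z0 := circ_subr_neq0.
have cz : ccontinuous (fun t => circ t - z).
  by apply: ccontinuousD (ccontinuous_cst _); exact: ccontinuous_circ.
have dz : cderivative (fun t => circ t - z) (fun t => 'i%C * circ t).
  apply: cderivative_eq (cderivativeD (@cderivative_circ R) (cderivative_cst (- z))) _.
  by move=> t /=; rewrite addr0.
have df := cderivativeM (cpm_derivative f m) (cderivativeV dz z0).
have cf := ccau f m.
have cd : ccontinuous (fun t => f.[circ t] * (circ t)^* ^+ m / (circ t - z) / (circ t - z)).
  exact: ccontinuous_cauchy cf z0.
have cf' : ccontinuous (fun t =>
    'i%C * (('X * f^`() - m%:R%:P * f).[circ t] * (circ t)^* ^+ m) / (circ t - z) +
    f.[circ t] * (circ t)^* ^+ m * (- ('i%C * circ t) / (circ t - z) ^+ 2)).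
  apply: ccontinuousD; apply: ccontinuousM => //.
  - exact: ccontinuousM (ccontinuous_cst _) (cpm _ _).
  - exact: ccontinuousV.
  - apply: ccontinuousM.
    + under eq_fun do rewrite -mulNr.
      by apply: ccontinuousM (ccontinuous_cst _) _; exact: ccontinuous_circ.
    + apply: ccontinuousV; first exact: ccontinuousX.
      by move=> t; rewrite expf_neq0.
have := wint_pearson iw hlam df cf cf'; rewrite -/b => e.
have cq := ccau q m.
have cD := ccontinuousM (ccontinuous_cst (- (z * (1 - z)))) cd.
apply: (mulfI i_neq0); apply/eqP; rewrite eq_sym -subr_eq0 -mulrBr -mulNr; apply/eqP.
rewrite /wcau /dwcau -(wintZ iw _ cd) -(wintD iw cq cD).
rewrite -(wintZ iw _ (ccontinuousD cq cD)) -e; apply: eq_wint => t _.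
rewrite /q !hE /=; have := z0 t.
move: ((circ t)^* ^+ m) (f.[circ t]) (f^`().[circ t]) (circ t) => y u v x x0.
by field.
Qed.

End WeightInnerProduct.

(** * Two by two matrices *)

Section Matrices.
Variable K : numFieldType.
Implicit Types a b c d z : K.

Lemma mx2P (A B : 'M[K]_2) : A 0 0 = B 0 0 -> A 0 1 = B 0 1 ->
  A 1 0 = B 1 0 -> A 1 1 = B 1 1 -> A = B.
Proof.
move=> h00 h01 h10 h11; apply/matrixP => i j.
by case: (unliftP 0 i) => [i'|] ->; case: (unliftP 0 j) => [j'|] ->;
  rewrite ?(ord1 i') ?(ord1 j'); do ?[rewrite (_ : lift 0 0 = 1); last exact: val_inj].
Qed.

Lemma mulmx2 a b c d a' b' c' d' : mx2 a b c d *m mx2 a' b' c' d' =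
  mx2 (a * a' + b * c') (a * b' + b * d') (c * a' + d * c') (c * b' + d * d').
Proof. by apply: mx2P; rewrite !mxE !big_ord_recl big_ord0 !mxE /= addr0. Qed.

Lemma scalemx2 e a b c d : e *: mx2 a b c d = mx2 (e * a) (e * b) (e * c) (e * d).
Proof. by apply: mx2P; rewrite !mxE. Qed.

Lemma mx2_unit a b c d : a * d - b * c = 1 -> mx2 a b c d \in unitmx.
Proof.
move=> e; apply: (@proj1 _ _ (mulmx1_unit (B := mx2 d (- b) (- c) a) _)).
rewrite mulmx2; have -> : a * - b + b * a = 0 by ring.
have -> : c * d + d * - c = 0 by ring.
have -> : a * d + b * - c = 1 by rewrite mulrN e.
have -> : c * - b + d * a = 1 by rewrite -e; ring.
by apply: mx2P; rewrite !mxE.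
Qed.

Lemma mx_cderive2 (F : K -> 'M[K]_2) f0 f1 f2 f3 z d0 d1 d2 d3 :
  Defs.eq_near F (fun w => mx2 (f0 w) (f1 w) (f2 w) (f3 w)) z ->
  has_cderive f0 z d0 -> has_cderive f1 z d1 -> has_cderive f2 z d2 ->
  has_cderive f3 z d3 -> mx_cderive F z = mx2 d0 d1 d2 d3.
Proof.
move=> nF h0 h1 h2 h3.
have entry i j f d : (forall w, mx2 (f0 w) (f1 w) (f2 w) (f3 w) i j = f w) ->
    has_cderive f z d -> cderive (fun w => F w i j) z = d.
  move=> ef df; apply: has_cderiveE; apply: has_cderive_near df.
  by move: nF; apply: filterS => w ->; rewrite ef.
by apply: mx2P; rewrite !mxE /=;
  [apply: entry h0|apply: entry h1|apply: entry h2|apply: entry h3] => w; rewrite !mxE.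
Qed.

(** By the reverse triangle inequality, the ball about z of radius the distance from |z| to r misses
    the circle of radius r. *)
Lemma near_norm_neq z (r : K) : `|z| != r -> r \is Num.real -> \forall w \near z, `|w| != r.
Proof.
move=> zr rr; have e0 : 0 < `| `|z| - r |.
  by rewrite normr_gt0 subr_eq0.
near=> w.
have wz : `|z - w| < `| `|z| - r |.
  by near: w; have := @nbhsx_ballx _ K z _ e0; rewrite -ball_normE.
apply/eqP => wr; move: wz; rewrite -wr; apply/negP.
by rewrite -real_leNgt ?normr_real// ler_dist_dist.
Unshelve. all: by end_near. Qed.

Lemma near_neq0 z : z != 0 -> \forall w \near z, w != 0.
Proof.
rewrite -normr_eq0 => /near_norm_neq /(_ (real0 _)); apply: filterS => w.
by rewrite normr_eq0.
Qed.

End Matrices.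

(** * The differential system *)

(** Here z is any scalar, taken as z (1 - z) below, and [k1], ..., [k4] are the derivatives of [y1],
    ..., [y4]. Since (1/u)' = - k/u, the two columns receive k with opposite signs, and u cancels
    from each. *)
Lemma ode_system (K : numFieldType) (z k u u' k1 k2 k3 k4 n11 n12 n21 n22 y1 y2 y3 y4 : K) :
  u != 0 -> u' = u * k ->
  z * k1 + z * k * y1 = n11 * y1 + n12 * y3 ->
  z * k2 - z * k * y2 = n11 * y2 + n12 * y4 ->
  z * k3 + z * k * y3 = n21 * y1 + n22 * y3 ->
  z * k4 - z * k * y4 = n21 * y2 + n22 * y4 ->
  z *: mx2 (k1 * u + y1 * u') (k2 * u^-1 + y2 * (- u' / u ^+ 2))
           (k3 * u + y3 * u') (k4 * u^-1 + y4 * (- u' / u ^+ 2)) =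
  mx2 n11 n12 n21 n22 *m mx2 (y1 * u) (y2 * u^-1) (y3 * u) (y4 * u^-1).
Proof.
move=> u0 -> h1 h2 h3 h4; rewrite scalemx2 mulmx2.
have e : - (u * k) / u ^+ 2 = - k * u^-1 by field.
rewrite e; congr mx2.
- transitivity ((z * k1 + z * k * y1) * u); first by ring.
  by rewrite h1; ring.
- transitivity ((z * k2 - z * k * y2) * u^-1); first by ring.
  by rewrite h2; ring.
- transitivity ((z * k3 + z * k * y3) * u); first by ring.
  by rewrite h3; ring.
- transitivity ((z * k4 - z * k * y4) * u^-1); first by ring.
  by rewrite h4; ring.
Qed.

Lemma scale_mul_invmx (K : fieldType) n (c : K) (A B N : 'M[K]_n) :
  B \in unitmx -> c *: A = N *m B -> c *: (A *m invmx B) = N.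
Proof. by move=> uB e; rewrite scalemxAl e mulmxK. Qed.

(** x, y are the values of Phi_n and Phi^*_{n-1}; X, Y those of their transforms [wcau]; c is 1/(2
    pi). The norm recurrence turns the coupling factor 1 - |a|^2 into 1/b_n, and adding or
    subtracting k makes the matrix traceless. *)
Lemma structure_system (K : numClosedFieldType)
    (z k b a bm bn u u' c n x y X Y dx dy dX dY : K) :
  let d := ((b + n) * z + (b^* + n) * (2 * `|a| ^+ 2 - 1)) / 2 in
  u != 0 -> u' = u * k -> bm != 0 -> bn^-1 = (1 - a * a^*) / bm ->
  z * (1 - z) * k = ((n - b) * z - (n + b^*)) / 2 ->
  z * (1 - z) * dx = (- n * z + (b^* + n) * (1 - a * a^*)) * x
                     + (1 - a * a^*) * (b^* + n) * a^* * y ->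
  z * (1 - z) * dX = (- b * z - (b^* + n) * (a * a^*)) * X
                     + (1 - a * a^*) * (b^* + n) * a^* * Y ->
  z * (1 - z) * dy = (b^* + n) * a * x + (b * z + (b^* + n) * (a * a^*)) * y ->
  z * (1 - z) * dY = (b^* + n) * a * X + (n * z - (b^* + n) * (1 - a * a^*)) * Y ->
  (z * (1 - z)) *: mx2 (dx * u + x * u') (c * dX * u^-1 + c * X * (- u' / u ^+ 2))
    (- bm * dy * u + - bm * y * u')
    (- bm * (c * dY) * u^-1 + - bm * (c * Y) * (- u' / u ^+ 2)) =
  mx2 (- d) (- (bn^-1 * (b^* + n) * a^*)) (- (bm * (b^* + n) * a)) d *m
  mx2 (x * u) (c * X * u^-1) (- bm * y * u) (- bm * (c * Y) * u^-1).
Proof.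
move=> d u0 u'E bm0 hB hk o1 o2 o3 o4; rewrite hB /d normCK.
apply: (ode_system u0 u'E); rewrite hk.
- by rewrite o1; field.
- by rewrite [_ * (c * _)]mulrCA o2; field.
- by rewrite [_ * (- bm * _)]mulrCA o3; field.
- by rewrite [_ * (- bm * _)]mulrCA [_ * (c * _)]mulrCA o4; field.
Qed.

(** * From the abstract system to Y_n, C_n and M_n *)

Section Assembly.
Variables (R : realType) (lam eta : R) (Phi : nat -> {poly R[i]}) (kappa : nat -> R).
Let b : R[i] := lam +i* eta.
Local Notation wt := (wt lam eta).
Hypotheses (hlam : - 2^-1 < lam) (hPhi : is_monic_OPUC b Phi kappa).

Let Phi_monic n : Phi n \is monic. Proof. by case: hPhi => /(_ n)[]. Qed.
Let size_Phi n : size (Phi n) = n.+1. Proof. by case: hPhi => /(_ n)[]. Qed.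
Let kappa_gt0 n : 0 < kappa n. Proof. by case: hPhi. Qed.

Let kap n : R[i] := (kappa n ^- 2)%:C.

Let kap_neq0 n : kap n != 0.
Proof. by rewrite eq_complex /= eqxx andbT invr_eq0 expf_neq0// gt_eqF. Qed.

Let wip_Phi n m : wip lam eta (Phi n) (Phi m) = kap n * (n == m)%:R.
Proof. by case: hPhi => _ _ <-; rewrite mu_integral_wint. Qed.

(* A divergent integral would have the junk value 0, whereas this one is [kappa 0 ^- 2]. *)
Lemma OPUC_integrable : lebesgue_measure.-integrable `]0, 2 * pi[ (EFin \o wt).
Proof.
apply: integrable_wt; apply: contraTneq isT => w0.
have Phi0 : Phi 0%N = 1.
  have := Phi_monic 0; rewrite (size1_polyC (eq_leq (size_Phi 0))).
  by rewrite monicE lead_coefC => /eqP ->.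
have := wip_Phi 0 0; rewrite /wip Phi0 eqxx mulr1 wintE.
have -> : (fun t : R => complex.Re ((1 : {poly R[i]}).[circ t] *
    ((1 : {poly R[i]}).[circ t])^*) * wt t) = wt.
  by apply/funext => t; rewrite hornerC rmorph1 mulr1 mul1r.
by rewrite w0 => /(congr1 (@complex.Re R)) /= /esym /eqP; rewrite invr_eq0 expf_eq0 /= gt_eqF.
Qed.

Let iw := OPUC_integrable.

(** With dt = i t dtheta, the factor t lowers m+1 to m and i cancels in 1/(2 pi i). Agreement of f
    and p on the circle is enough, which lets [Phistar] be replaced by a polynomial. *)
Lemma cauchy_transformE m (f : R[i] -> R[i]) (p : {poly R[i]}) (z : R[i]) :
  (forall t, f (circ t) = p.[circ t]) -> `|z| != 1 ->
  cauchy_transform b m.+1 f z = (2 * pi)%:C^-1 * wcau lam eta z m p.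
Proof.
move=> fp z1; rewrite /cauchy_transform.
have -> : (fun t => f t / (t - z) * (nu b t / t ^+ m.+1)) =
    (fun t => f t / (t - z) / t ^+ m.+1 * nu b t).
  by apply/funext => t; rewrite mulrA mulrAC.
rewrite circle_integral_nu.
have i0 : 'i%C != 0 :> R[i] by rewrite eq_complex /= oner_eq0 andbF.
have -> : wint wt (fun t => f (circ t) / (circ t - z) / circ t ^+ m.+1 * ('i%C * circ t)) =
    'i%C * wcau lam eta z m p.
  rewrite /wcau -wintZ//; last first.
    apply: ccontinuous_cauchy; last by move=> t; exact: circ_subr_neq0.
    apply: ccontinuousM; first by apply: ccontinuous_horner; exact: ccontinuous_circ.
    by apply: ccontinuousX; apply: ccontinuousJ; exact: ccontinuous_circ.
  apply: eq_wint => t _; rewrite fp circ_conjV exprS exprVn.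
  have := circ_subr_neq0 z1 t; have := circ_neq0 t.
  move: (p.[circ t]) (circ t) => y x x0 xz; field.
  by rewrite xz x0 expf_neq0.
have -> : (2 * pi)%:C = 2 * pi%:C :> R[i] by rewrite rmorphM rmorph_nat.
have p0 : pi%:C != 0 :> R[i] by rewrite eq_complex /= eqxx andbT gt_eqF// pi_gt0.
by move: (pi%:C) p0 ('i%C) i0 => x x0 y y0; field; rewrite x0 y0.
Qed.

Lemma Mmx_formula m (z : R[i]) C : `|z| != 1 -> z != 0 -> C_branch b m.+1 z C ->
  let n := m.+1 in
  let a : R[i] := alpha Phi n.-1 in
  let d : R[i] :=
    ((b + n%:R) * z + (b^* + n%:R) * (2 * `|a| ^+ 2 - 1)) / 2 in
  (z * (1 - z)) *: Mmx b Phi kappa n C z =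
  mx2 (- d)
      (- ((bcoef kappa n)^-1 * (b^* + n%:R) * a^*))
      (- (bcoef kappa n.-1 * (b^* + n%:R) * a))
      d.
Proof.
move=> z1 z0 hC n a d.
have z10 : 1 - z != 0 by rewrite subr_eq0; apply: contraNneq z1 => <-; rewrite normr1.
have [u [u0 du eC]] := C_branch_diag z0 z10 hC.
set k := - (n%:R + b^*) / (2 * z) - (b + b^*) / (2 * (1 - z)) in du.
pose P := revpoly m (Phi m).
have PE w : w != 0 -> Phistar Phi m w = P.[w].
  by move=> w0; rewrite /P horner_revpoly ?size_Phi.
pose bm : R[i] := bcoef kappa m.
pose c : R[i] := (2 * pi)%:C^-1.
pose f1 (w : R[i]) : R[i] := (Phi n).[w]; pose f2 (w : R[i]) : R[i] := c * wcau lam eta w m (Phi n).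
pose f3 (w : R[i]) : R[i] := - bm * P.[w]; pose f4 (w : R[i]) : R[i] := - bm * (c * wcau lam eta w m P).
(* An identity on a neighbourhood, as it is to be differentiated: points near z stay off 0 and off
   the circle. *)
have nearY : Defs.eq_near (Y b Phi kappa n) (fun w => mx2 (f1 w) (f2 w) (f3 w) (f4 w)) z.
  near=> w.
  have w0 : w != 0 by near: w; exact: near_neq0.
  have w1 : `|w| != 1 by near: w; exact: near_norm_neq z1 (real1 _).
  rewrite /Y /G /Gstar /= -/n PE// (cauchy_transformE m (p := Phi n))//.
  by rewrite (cauchy_transformE m (p := P))// => t; rewrite PE// circ_neq0.
pose Z w := Y b Phi kappa n w *m C w.
have nearZ : Defs.eq_near Z (fun w => mx2 (f1 w * u w) (f2 w * (u w)^-1)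
                               (f3 w * u w) (f4 w * (u w)^-1)) z.
  near=> w; rewrite /Z (near nearY w)// (near eC w)// mulmx2.
  by rewrite !mulr0 !add0r !addr0.
have dV := has_cderiveV u0 du.
have d1 : has_cderive f1 z (Phi n)^`().[z] by exact: has_cderive_horner.
have d2 : has_cderive f2 z (c * dwcau lam eta z m (Phi n)).
  by apply: has_cderiveZ; exact: has_cderive_wcau.
have d3 : has_cderive f3 z (- bm * P^`().[z]).
  by apply: has_cderiveZ; exact: has_cderive_horner.
have d4 : has_cderive f4 z (- bm * (c * dwcau lam eta z m P)).
  by do 2 apply: has_cderiveZ; exact: has_cderive_wcau.
rewrite /Mmx -/Z (mx_cderive2 nearZ (has_cderiveM d1 du) (has_cderiveM d2 dV)
  (has_cderiveM d3 du) (has_cderiveM d4 dV)) -/(Z z) (nbhs_singleton nearZ).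
have [ipD ipZ] := (wipDl iw, wipZl iw).
have Sszego := kap_recurrence ipD ipZ (wipC iw) (wipX lam eta) Phi_monic size_Phi kap_neq0 wip_Phi m.
have det := cauchy_determinant ipD ipZ (wipC iw) (wipX lam eta) Phi_monic size_Phi kap_neq0 wip_Phi
  (wcauD iw z1) (wcauZ iw z1) (wcauX iw z1) (wcauS lam eta z1) m.
have prs := wip_pearson iw hlam.
have o1 := Phi_ode ipD ipZ (wipC iw) (wipX lam eta) Phi_monic size_Phi kap_neq0 wip_Phi prs z m.
have o3 := Phistar_ode ipD ipZ (wipC iw) (wipX lam eta) Phi_monic size_Phi kap_neq0 wip_Phi prs z m.
have o2 := cauchy_Phi_ode ipD ipZ (wipC iw) (wipX lam eta) Phi_monic size_Phi kap_neq0 wip_Phi prs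
  (wcauD iw z1) (wcauZ iw z1) (wcauX iw z1) (wcau_pearson iw hlam z1) m.
have o4 := cauchy_Phistar_ode ipD ipZ (wipC iw) (wipX lam eta) Phi_monic size_Phi kap_neq0 wip_Phi prs
  (wcauD iw z1) (wcauZ iw z1) (wcauX iw z1) (wcau_pearson iw hlam z1) m.
have va : verblunsky Phi m = a by [].
rewrite va in Sszego o1 o2 o3 o4.
have bm0 : bm != 0.
  by rewrite eq_complex /= eqxx andbT !mulf_neq0 ?expf_neq0 ?gt_eqF// pi_gt0.
have bE l : bcoef kappa l = (2 * pi)%:C / kap l.
  rewrite /bcoef /kap -fmorphV -rmorphM invrK //.
have pi0 : (2 * pi)%:C != 0 :> R[i].
  by rewrite eq_complex /= eqxx andbT mulf_neq0 ?gt_eqF// pi_gt0.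
have hB : (bcoef kappa n)^-1 = (1 - a * a^*) / bm.
  by rewrite /bm /n !bE Sszego !invfM !invrK mulrCA.
have hk : z * (1 - z) * k = ((n%:R - b) * z - (n%:R + b^*)) / 2.
  by rewrite /k; field; rewrite z0 z10.
have bmc : bm * c = (kap m)^-1 by rewrite /bm bE /c mulrC mulKf.
(* u cancels, so this is det Y_n: the abstract determinant - [kap m] against the normalization -
   [bm * c] = - 1/[kap m]. *)
have det1 : f1 z * u z * (f4 z * (u z)^-1) - f2 z * (u z)^-1 * (f3 z * u z) = 1.
  transitivity (- (bm * c) * ((Phi n).[z] * wcau lam eta z m P - P.[z] * wcau lam eta z m (Phi n))).
    by rewrite /f1 /f2 /f3 /f4; field.
  by rewrite det bmc mulrNN mulVf.
apply: (@scale_mul_invmx (R[i] : numFieldType)); first exact: mx2_unit.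
exact: (@structure_system R[i] z k b a bm (bcoef kappa n) (u z) (u z * k) c n%:R
  _ _ _ _ _ _ _ _ u0 erefl bm0 hB hk o1 o2 o3 o4).
Unshelve. all: by end_near. Qed.

End Assembly.

Theorem mainTheorem10 (R : realType) (lambda eta : R)
    (Phi : nat -> {poly R[i]}) (kappa : nat -> R) :
  - 2^-1 < lambda ->
  let b : R[i] := lambda +i* eta in
  is_monic_OPUC b Phi kappa ->
  forall n : nat, (0 < n)%N ->
  forall z : R[i], `|z| != 1 -> z != 0 ->
  forall C : R[i] -> 'M[R[i]]_2, C_branch b n z C ->
  let a : R[i] := alpha Phi n.-1 in
  let d : R[i] :=
    ((b + n%:R) * z + (b^* + n%:R) * (2 * `|a| ^+ 2 - 1)) / 2 in
  (z * (1 - z)) *: Mmx b Phi kappa n C z =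
  mx2 (- d)
      (- ((bcoef kappa n)^-1 * (b^* + n%:R) * a^*))
      (- (bcoef kappa n.-1 * (b^* + n%:R) * a))
      d.
Proof.
move=> hlam b hPhi [//|m] _ z z1 z0 C hC.
exact: Mmx_formula hlam hPhi m z C z1 z0 hC.
Qed.
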